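(* Let $\vec p=(1,p_2)$ with $1<p_2<\infty$, and let $\vec a,\vec b,\vec c\in\mathbb{R}^2$, $\vec\alpha\in(-1,\infty)^2$. Then the following are equivalent: (1) $S_{\vec a,\vec b,\vec c}$ is bounded from $L^{\vec p}_{\vec\alpha}(T_B\times T_B)$ to $L^\infty(T_B\times T_B)$; (2) $T_{\vec a,\vec b,\vec c}$ is bounded from $L^{\vec p}_{\vec\alpha}(T_B\times T_B)$ to $L^\infty(T_B\times T_B)$; (3) $a_1\ge0$, $a_2>0$, $b_1\ge\alpha_1$, $p_2(b_2+1)>\alpha_2+1$, $c_1=a_1+b_1-\alpha_1$, and $c_2=n+1+a_2+b_2-\frac{n+1+\alpha_2}{p_2}$.
   Context: Let $n$ be a positive integer. For $z=(z_1,\dots,z_n)\in\mathbb{C}^n$ write $z=x+iy$ with $x,y\in\mathbb{R}^n$, $z'=(z_1,\dots,z_{n-1})$, $y'=(y_1,\dots,y_{n-1})$. Let $B=\{y\in\mathbb{R}^n: |y'|^2<y_n\}$ and $T_B=\{x+iy: x\in\mathbb{R}^n, y\in B\}$. For $z\in T_B$ put $\rho(z)=y_n-|y'|^2>0$, and for $z,u\in T_B$ put $\rho(z,u)=\frac14\big(\sum_{j=1}^{n-1}(z_j-\overline{u_j})^2-2i(z_n-\overline{u_n})\big)$; this has positive real part, and complex powers $\rho(z,u)^c$ are taken with the principal branch. $dV$ is Lebesgue measure on $\mathbb{C}^n$ and $dV_\alpha(z)=\rho(z)^\alpha dV(z)$. For $\vec p=(p_1,p_2)\in[1,\infty]^2$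 and $\vec\alpha=(\alpha_1,\alpha_2)$, $L^{\vec p}_{\vec\alpha}(T_B\times T_B)$ is the space of measurable $f$ on $T_B\times T_B$ with finite mixed norm $\|f\|_{\vec p,\vec\alpha}=\big\{\int_{T_B}\big(\int_{T_B}|f(z,w)|^{p_1}dV_{\alpha_1}(z)\big)^{p_2/p_1}dV_{\alpha_2}(w)\big\}^{1/p_2}$, with the inner (resp. outer) integral replaced by an essential supremum in $z$ (resp. $w$) when $p_1=\infty$ (resp. $p_2=\infty$); when $\vec p=(\infty,\infty)$ this is $L^\infty(T_B\times T_B)$. For $\vec a=(a_1,a_2),\vec b=(b_1,b_2),\vec c=(c_1,c_2)\in\mathbb{R}^2$, $T_{\vec a,\vec b,\vec c}f(z,w)=\rho(z)^{a_1}\rho(w)^{a_2}\int_{T_B}\int_{T_B}\frac{\rho(u)^{b_1}\rho(\eta)^{b_2}}{\rho(z,u)^{c_1}\rho(w,\eta)^{c_2}}f(u,\eta)\,dV(u)\,dV(\eta)$ and $S_{\vec a,\vec b,\vec c}f(z,w)=\rho(z)^{a_1}\rho(w)^{a_2}\int_{T_B}\int_{T_B}\frac{\rho(u)^{b_1}\rho(\eta)^{b_2}}{|\rho(z,u)|^{c_1}|\rho(w,\eta)|^{c_2}}f(u,\eta)\,dV(u)\,dV(\eta)$. An operator is bounded from $X$ to $Y$ if for every $f\in X$ the defining integral converges for a.e. $(z,w)$ and $\|Tf\|_Y\le C\|f\|_X$ with $C$ independent of $f$. *)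

(* Defs.v *)
From HB Require Import structures.
From mathcomp Require Import all_boot all_order all_algebra complex.
From mathcomp Require Import all_classical all_reals all_analysis.

Import Order.TTheory GRing.Theory Num.Theory.
Import numFieldNormedType.Exports.

Local Open Scope classical_set_scope.
Local Open Scope ring_scope.

(** Product of two sigma-finite measures, packaged under a fresh head symbol
    (the library's own instance for m1 \x m2 is shadowed by another canonical
    instance with the same key). pmeas m1 m2 is definitionally m1 \x m2. *)
Section PS.
Local Open Scope ereal_scope.
Context d1 d2 (T1 : measurableType d1) (T2 : measurableType d2) (R : realType).
Variable m1 : {sigma_finite_measure set T1 -> \bar R}.
Variable m2 : {sigma_finite_measure set T2 -> \bar R}.
Definition pmeas := (m1 \x m2).
HB.instance Definition _ := Measure.copy pmeas (m1 \x m2).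
Lemma pmeas_sigma_finite : sigma_finite setT pmeas.
Proof.
have /sigma_finiteP[F [TF ndF Foo]] := sigma_finiteT m1.
have /sigma_finiteP[G [TG ndG Goo]] := sigma_finiteT m2.
exists (fun n => F n `*` G n).
 rewrite -setXTT TF TG predeqE => -[x y]; split.
    move=> [/= [n _ Fnx] [k _ Gky]]; exists (maxn n k) => //; split.
    - by move: x Fnx; exact/subsetPset/ndF/leq_maxl.
    - by move: y Gky; exact/subsetPset/ndG/leq_maxr.
  by move=> [n _ []/= ? ?]; split; exists n.
move=> k; have [? ?] := Foo k; have [? ?] := Goo k.
split; first exact: measurableX.
by rewrite /pmeas product_measure1E// lte_mul_pinfty// ge0_fin_numE.
Qed.
HB.instance Definition _ := Measure_isSigmaFinite.Build _ _ _ pmeas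
  pmeas_sigma_finite.
End PS.
Arguments pmeas {d1 d2 T1 T2 R} m1 m2.

Section Defs.
Variable R : realType.

(** * Lebesgue measure on R^k, built as the iterated product
      R * (R * ( ... * unit)) of Lebesgue measures on R. *)
Record RnS := RnS_mk {
  rn_d : measure_display;
  rn_T : measurableType rn_d;
  rn_mu : {sigma_finite_measure set rn_T -> \bar R} }.

Fixpoint Rn (k : nat) : RnS :=
  match k with
  | 0 => @RnS_mk _ unit (@dirac _ unit tt R)
  | k'.+1 => @RnS_mk _ _ (pmeas (@lebesgue_measure R) (rn_mu (Rn k')))
  end.

(** i-th coordinate of a point of R^k (0 for i >= k). *)
Fixpoint coord (k : nat) : rn_T (Rn k) -> nat -> R :=
  match k as k0 return rn_T (Rn k0) -> nat -> R with
  | 0 => fun _ _ => 0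
  | k'.+1 => fun (v : (R * rn_T (Rn k'))%type) i =>
      match i with 0 => v.1 | i'.+1 => coord k' v.2 i' end
  end.

(** C^n identified with R^(2n): z_j = x_j + i y_j with x_j = coordinate 2j,
    y_j = coordinate 2j+1, for j = 0, ..., n-1 (so the paper's z_n is index n-1). *)
Definition Cn (n : nat) := rn_T (Rn (2 * n)).
Definition dV (n : nat) : {sigma_finite_measure set Cn n -> \bar R} := rn_mu (Rn (2 * n)).
Definition dV2 (n : nat) := pmeas (dV n) (dV n).

Definition xc n (z : Cn n) (j : nat) : R := coord (2 * n) z (2 * j).
Definition yc n (z : Cn n) (j : nat) : R := coord (2 * n) z (2 * j + 1).
Definition zc n (z : Cn n) (j : nat) : R[i] := Complex (xc n z j) (yc n z j).

(** rho(z) = y_n - |y'|^2 and the tube domain T_B *)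
Definition rho n (z : Cn n) : R :=
  yc n z n.-1 - \sum_(j < n.-1) (yc n z j) ^+ 2.
Definition TB n : set (Cn n) := [set z | 0 < rho n z].

(** rho(z,u) = 1/4 ( sum_{j<n} (z_j - conj u_j)^2 - 2i (z_n - conj u_n) ) *)
Definition rho2 n (z u : Cn n) : R[i] :=
  ((1 / 4 : R)%:C * (\sum_(j < n.-1) (zc n z j - (zc n u j)^*) ^+ 2
     - (2 : R)%:C * 'i * (zc n z n.-1 - (zc n u n.-1)^*)))%C.

(** modulus, principal argument in (-pi, pi], principal real power *)
Definition cmod (w : R[i]) : R := Num.sqrt (complex.Re w ^+ 2 + complex.Im w ^+ 2).
Definition Arg (w : R[i]) : R :=
  let x := complex.Re w in let y := complex.Im w in
  if 0 < x then atan (y / x)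
  else if x < 0 then (if 0 <= y then atan (y / x) + pi else atan (y / x) - pi)
  else if 0 < y then pi / 2 else if y < 0 then - (pi / 2) else 0.
(** w^c = exp(c Log w) = |w|^c (cos (c Arg w) + i sin (c Arg w)), w <> 0 *)
Definition cpow (w : R[i]) (c : R) : R[i] :=
  Complex (powR (cmod w) c * cos (c * Arg w)) (powR (cmod w) c * sin (c * Arg w)).

(** kernels: 1/rho(z,u)^c  (T) and 1/|rho(z,u)|^c (S) *)
Definition Tker n (z u : Cn n) (c : R) : R[i] := (cpow (rho2 n z u) c)^-1.
Definition Sker n (z u : Cn n) (c : R) : R[i] := ((powR (cmod (rho2 n z u)) c)^-1)%:C%C.

(** Complex-valued Lebesgue integral over T_B x T_B (w.r.t. dV(u) dV(eta)):
    convergence = absolute integrability of real and imaginary parts. *)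
Definition cintegrable n (g : Cn n * Cn n -> R[i]) : Prop :=
  (dV2 n).-integrable (TB n `*` TB n) (EFin \o (fun p => complex.Re (g p))) /\
  (dV2 n).-integrable (TB n `*` TB n) (EFin \o (fun p => complex.Im (g p))).
Definition cint n (g : Cn n * Cn n -> R[i]) : R[i] :=
  Complex (Rintegral (dV2 n) (TB n `*` TB n) (fun p => complex.Re (g p)))
          (Rintegral (dV2 n) (TB n `*` TB n) (fun p => complex.Im (g p))).

(** integrand of the operator with kernel K at the point (z,w) *)
Definition op_integrand n (K : Cn n -> Cn n -> R -> R[i]) (b c : R * R)
  (f : Cn n * Cn n -> R[i]) (zw : Cn n * Cn n) : Cn n * Cn n -> R[i] :=
  fun ue => (K zw.1 ue.1 c.1 * K zw.2 ue.2 c.2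
             * (powR (rho n ue.1) b.1 * powR (rho n ue.2) b.2)%:C * f ue)%C.

Definition op_value n (K : Cn n -> Cn n -> R -> R[i]) (a b c : R * R)
  (f : Cn n * Cn n -> R[i]) (zw : Cn n * Cn n) : R[i] :=
  ((powR (rho n zw.1) a.1 * powR (rho n zw.2) a.2)%:C * cint n (op_integrand n K b c f zw))%C.

(** mixed norm ||f||_{(p1,p2),(al1,al2)} for finite p1, p2 *)
Definition mixed_norm n (p al : R * R) (f : Cn n * Cn n -> R[i]) : \bar R :=
  ((\int[dV n]_(w in TB n)
      (((\int[dV n]_(z in TB n)
           ((powR (cmod (f (z, w))) p.1 * powR (rho n z) al.1)%:E)) `^ (p.2 / p.1))
        * (powR (rho n w) al.2)%:E)) `^ (p.2^-1))%E.

(** f in L^{(p1,p2)}_{(al1,al2)}(T_B x T_B): measurable on T_B x T_B, finite norm *)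
Definition in_Lmixed n (p al : R * R) (f : Cn n * Cn n -> R[i]) : Prop :=
  measurable_fun (TB n `*` TB n) (fun x => complex.Re (f x)) /\
  measurable_fun (TB n `*` TB n) (fun x => complex.Im (f x)) /\
  (mixed_norm n p al f < +oo)%E.

(** boundedness from L^{p}_{al}(T_B x T_B) to L^oo(T_B x T_B):
    for every f, for a.e. (z,w) in T_B x T_B the defining integral converges
    and |Op f (z,w)| <= C ||f||  (i.e. ess sup |Op f| <= C ||f||). *)
Definition bounded_to_Linf n (K : Cn n -> Cn n -> R -> R[i]) (a b c : R * R)
  (p al : R * R) : Prop :=
  exists C : R, forall f : Cn n * Cn n -> R[i], in_Lmixed n p al f ->
    {ae dV2 n, forall zw, (TB n `*` TB n) zw ->
       cintegrable n (op_integrand n K b c f zw) /\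
       ((cmod (op_value n K a b c f zw))%:E <= C%:E * mixed_norm n p al f)%E}.

Definition S_bounded n (a b c p al : R * R) := bounded_to_Linf n (Sker n) a b c p al.
Definition T_bounded n (a b c p al : R * R) := bounded_to_Linf n (Tker n) a b c p al.

End Defs.

(* Main.v *)
Require Import Defs.
From HB Require Import structures.
From mathcomp Require Import all_boot all_order all_algebra complex.
From mathcomp Require Import all_classical all_reals all_analysis.
From mathcomp Require Import measurable_realfun measurable_fun_approximation ring lra.
Import Order.TTheory GRing.Theory Num.Def Num.Theory.
Import numFieldNormedType.Exports.
Local Open Scope classical_set_scope.
Local Open Scope ring_scope.

(** Writing [z = x + iy] and [u = s + it], one has
    [4 Re rho(z,u) = |z' - u'|^2 + 2 rho(z) + 2 rho(u)], so [rho(z)] and [rho(u)] are at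
    most [2 |rho(z,u)|].

    Sufficiency holds at every point [(z,w)].  In the first variable the kernel divided by
    the weight is bounded, because [c1 = a1 + (b1 - al1)] with both terms nonnegative; in
    the second variable Hoelder's inequality leaves the integral of
    [rho^s |rho(w,.)|^(-t)] with [s = q (b2 - al2/p)] and [t = q c2], which is at most
    [C rho(w)^(-q a2)]: integrate the coordinates one after the other.

    Necessity uses the functions [1_E(u) sum_i m_i 1_(E_i)(eta)], where [E] and the [E_i]
    are parabolic boxes centred on the imaginary axis of the last coordinate.  There
    [rho(z,u)] is so close to the positive half-line that the real part of the kernel is
    at least half its modulus, hence [T] behaves like [S].  One box and its dilates give
    the two equalities and [a1 >= 0], [b1 >= al1]; [N] dyadic boxes with equal
    contributions give [N <= C N^(1/p)] unless [a2 > 0] and [p (b2 + 1) > al2 + 1]. *)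

(** * One-dimensional integrals *)

(** The first variable gets weak inequalities and the second strict ones because the exponent dual
    to 1 is infinite: a supremum has to be finite there, whereas in the second variable an integral
    has to converge. At [a.2 = 0] or [p (b.2 + 1) = al.2 + 1] that integral diverges only
    logarithmically, which no single box detects. Dyadic layers do detect it, since each contributes
    the same amount, and [p > 1] makes [N] outgrow [N^(1/p)].

    The order of coordinates in [Rn] is essential to the kernel integral. The last two real
    coordinates, [x_n] and [y_n], are integrated first, with [z'] frozen. Then [T_B] is a half-line
    in [y_n] and the imaginary part of [rho(w,.)] is a translate of [x_n], so translation invariance
    on the line disposes of the curved domain without a change of variables on R^k.

    In the converse direction the estimate is known only almost everywhere, so [(z,w)] too must
    range over boxes of positive measure. The kernel of [T] must be nearly real on all these boxes
    at once; this limits their horizontal size to a small multiple [e2] of the heights involved. *)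

Section OneDim.
Context {R : realType}.
Local Notation leb := (@lebesgue_measure R).

Lemma measurable_shift (c : R) : measurable_fun [set: R] (fun x : R => x - c).
Proof. exact: measurable_funB. Qed.

(** The pushforward under the shift gives half-open intervals their length, and this determines
    Lebesgue measure. *)
Lemma lebesgue_measure_shift (c : R) (A : set R) : measurable A ->
  leb A = leb ((fun x : R => x - c) @^-1` A).
Proof.
move=> mA.
pose phi : measurableTypeR R -> measurableTypeR R := fun x : R => x - c.
pose mu : {measure set (measurableTypeR R) -> \bar R} := pushforward leb phi.
rewrite (@lebesgue_measure_unique R (mu (measurable_shift c)))// => X [[a b] /= _ <-].
rewrite /mu/= /pushforward/=.
have -> : (fun x : R => x - c) @^-1` `]a, b]%classic = `]a + c, b + c]%classic.
  by apply/seteqP; split => x /=; rewrite !in_itv/= ltrBrDr lerBlDr.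
rewrite !lebesgue_measure_itv/= !lte_fin ltrD2r.
by case: ifP => // _; rewrite -!EFinB; congr EFin; ring.
Qed.

Lemma ge0_integral_shift (c : R) (f : R -> \bar R) :
  measurable_fun setT f -> (forall x, 0 <= f x)%E ->
  (\int[leb]_x f (x - c)%R = \int[leb]_x f x)%E.
Proof.
move=> mf f0.
have := @ge0_integral_pushforward _ _ (measurableTypeR R) (measurableTypeR R) R
  (fun x : R => x - c)
  (measurable_shift c) leb setT f measurableT mf (fun x _ => f0 x).
rewrite preimage_setT => <-.
apply: eq_measure_integral => [|? A mA _]; first exact: measurable_shift.
by rewrite /= /pushforward/=; apply/esym; exact: lebesgue_measure_shift.
Qed.

(** The integrand may blow up at 0 and the interval is unbounded, so the fundamental theorem is
    applied on compact intervals exhausting the half-line. Each integral is a difference of two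
    values of [F] in [[0, M]]. *)
Lemma ge0_integral_le_antiderivative (f F : R -> R) (M : R) :
  (forall x : R, 0 < x -> is_derive x 1 F (f x)) ->
  (forall x : R, 0 < x -> {for x, continuous f}) ->
  (forall x : R, 0 < x -> 0 <= f x) ->
  (forall x : R, 0 < x -> 0 <= F x <= M) ->
  (\int[leb]_(x in `]0%R, +oo[) (f x)%:E <= M%:E)%E.
Proof.
move=> dF cf f0 FM.
(* The right end is [k + 2] so that already [I 0 = [1, 2]] is nondegenerate. *)
pose I (k : nat) : set R := `[(k.+1%:R)^-1, k.+2%:R]%classic.
have IE : `]0, +oo[%classic = \bigcup_k I k.
  apply/seteqP; split => [x|x [k _]]; rewrite /I/= !in_itv/= ?andbT.
    move=> x0; exists (maxn (Num.truncn x) (Num.truncn x^-1)) => //=.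
    rewrite in_itv/=; apply/andP; split.
      rewrite invf_ple ?posrE//; apply: ltW.
      apply: (lt_le_trans (truncnS_gt _)).
      by rewrite ler_nat ltnS leq_maxr.
    apply: ltW; apply: (lt_le_trans (truncnS_gt _)).
    by rewrite ler_nat ltnS; apply: leqW; exact: leq_maxl.
  by move=> /andP[+ _]; apply: lt_le_trans; rewrite invr_gt0.
have mI k : measurable (I k) by exact: measurable_itv.
have Ipos k x : I k x -> 0 < x.
  by rewrite /I/= in_itv/= => /andP[+ _]; apply: lt_le_trans; rewrite invr_gt0.
have mf : measurable_fun (`]0, +oo[%classic : set R) f.
  apply: open_continuous_measurable_fun => // x.
  by rewrite inE/= in_itv/= andbT; exact: cf.
have cI : (fun i => \int[leb]_(x in I i) (f x)%:E)%E @ \oo -->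
    (\int[leb]_(x in `]0%R, +oo[) (f x)%:E)%E.
  rewrite IE; apply: ge0_nondecreasing_set_cvg_integral => //.
  - apply/nondecreasing_seqP => k; apply/subsetPset => x; rewrite /I/= !in_itv/=.
    move=> /andP[h1 h2]; apply/andP; split.
      by apply: le_trans h1; rewrite lef_pV2 ?posrE// ler_nat.
    by apply: (le_trans h2); rewrite ler_nat.
  - move=> k; apply/measurable_EFinP; apply: measurable_funS mf => // x /Ipos.
    by rewrite /= in_itv/= andbT.
  - by move=> k x /Ipos x0; rewrite lee_fin f0.
rewrite -(cvg_lim _ cI)//; apply: lime_le; first by apply/cvg_ex; eexists; exact: cI.
apply: nearW => k.
have lt : (k.+1%:R)^-1 < k.+2%:R :> R.
  by rewrite (@le_lt_trans _ _ 1)// ?ltr1n// invf_le1// ler1n.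
have kp : 0 < (k.+1%:R)^-1 :> R by rewrite invr_gt0.
have Fc x : 0 < x -> {for x, continuous F}.
  move=> x0; apply: differentiable_continuous; apply/derivable1_diffP.
  by have := dF x x0; case.
rewrite (@continuous_FTC2 _ f F)//.
- rewrite -EFinB lee_fin.
  have := FM _ kp; have := FM _ (lt_trans kp lt); lra.
- apply: continuous_in_subspaceT => x; rewrite inE => /Ipos; exact: cf.
- split.
  + move=> x; rewrite in_itv/= => /andP[h _].
    by have := dF x (lt_trans kp h); case.
  + by apply: cvg_at_right_filter; apply: Fc.
  + by apply: cvg_at_left_filter; apply: Fc; exact: lt_trans lt.
- move=> x; rewrite in_itv/= => /andP[h _].
  by rewrite derive1E; have := dF x (lt_trans kp h) => ?; rewrite derive_val.
Qed.

Lemma is_derive_congr (f g : R -> R) (x df dg : R) : f = g -> df = dg ->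
  is_derive x 1 f df -> is_derive x 1 g dg.
Proof. by move=> -> ->. Qed.

Lemma continuous_powR_pos (p x : R) : 0 < x -> {for x, continuous (@powR R ^~ p)}.
Proof.
move=> x0; apply: differentiable_continuous; apply/derivable1_diffP.
by apply: derivable_powR; rewrite in_itv/= x0.
Qed.

Lemma continuous_powRD_pos (A p x : R) : 0 < A + x ->
  {for x, continuous (fun x => (A + x) `^ p)}.
Proof.
move=> x0; apply: (@continuous_comp _ _ _ (fun x => A + x) (@powR R ^~ p)).
  by apply: cvgD; [exact: cvg_cst|exact: cvg_id].
exact: continuous_powR_pos.
Qed.

Lemma is_derive_powRD (A p x : R) : 0 < A + x ->
  is_derive x 1 (fun x => (A + x) `^ p) (p * (A + x) `^ (p - 1)).
Proof.
move=> x0.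
have d1 : is_derive x 1 (fun x => A + x) (1 : R).
  have := is_deriveD (is_derive_cst A x 1) (is_derive_id x 1).
  by rewrite add0r.
have d2 := is_derive1_powR p x0.
have := @is_derive1_comp _ (@powR R ^~ p) (fun x => A + x) x _ _ d2 d1.
by rewrite mulr1.
Qed.

Lemma integral_powRD_norm (A q : R) : 0 < A -> 1 < q ->
  (\int[leb]_x ((A + `|x|) `^ (- q))%:E <= (2 * (A `^ (1 - q) / (q - 1)))%:E)%E.
Proof.
move=> A0 q1.
have Ap (x : R) : 0 <= x -> 0 < A + x by move=> ?; rewrite ltr_wpDr.
rewrite ge0_symfun_integralT; first last.
- by move=> x /=; rewrite normrN.
- move=> x; apply: (@continuous_comp _ _ _ (@normr _ R) (fun x => (A + x) `^ (- q))).
    exact: norm_continuous.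
  by apply: continuous_powRD_pos; rewrite Ap.
- by move=> x; rewrite powR_ge0.
rewrite EFinM; apply: lee_wpmul2l; first by rewrite lee_fin.
have -> : [set x : R | 0 <= x] = `[0, +oo[%classic by rewrite set_itvcy.
have mf : measurable_fun (`]0, +oo[%classic : set R) (fun x : R => (A + `|x|) `^ (- q)).
  apply: measurable_funTS.
  apply: (@measurableT_comp _ _ _ _ _ _ (@powR R ^~ (- q))).
    exact: measurable_powR.
  by apply: measurable_funD => //; exact: normr_measurable.
rewrite -integral_itv_obnd_cbnd; last exact/measurable_EFinP.
have -> : (\int[leb]_(x in `]0%R, +oo[) ((A + `|x|) `^ (- q))%:E =
    \int[leb]_(x in `]0%R, +oo[) ((A + x) `^ (- q))%:E)%E.
  apply: eq_integral => x; rewrite inE/= in_itv/= andbT => x0.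
  by rewrite (gtr0_norm x0).
(* The additive constant makes [F] vanish at 0, so that it stays between 0 and its limit at
   infinity. *)
pose F (x : R) := A `^ (1 - q) / (q - 1) - (A + x) `^ (1 - q) / (q - 1).
have q10 : 0 < q - 1 by rewrite subr_gt0.
apply: (@ge0_integral_le_antiderivative (fun x => (A + x) `^ (- q)) F) => x x0.
- have x0' := Ap _ (ltW x0).
  have d := is_derive_powRD A (1 - q) x x0'.
  have := is_deriveB (is_derive_cst (A `^ (1 - q) / (q - 1)) x 1)
    (is_deriveZ (q - 1)^-1 d).
  rewrite sub0r /GRing.scale/=; apply: is_derive_congr.
    apply/funext => y; rewrite /F [X in _ = _ - X]mulrC.
    by rewrite -[LHS]/(_ - _ * _).
  have -> : 1 - q - 1 = - q by ring.
  by field; exact: lt0r_neq0.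
- by apply: continuous_powRD_pos; rewrite Ap// ltW.
- exact: powR_ge0.
- rewrite /F -mulrBl; apply/andP; split.
    rewrite mulr_ge0 ?invr_ge0 ?(ltW q10)// subr_ge0.
    have -> : 1 - q = - (q - 1) by ring.
    rewrite !powRN lef_pV2 ?posrE ?powR_gt0 ?Ap ?(ltW x0)//.
    apply: ge0_ler_powR; rewrite ?nnegrE ?ltW ?Ap//; [exact: ltW|by rewrite ltrDl].
  rewrite ler_pM2r ?invr_gt0// gerBl powR_ge0//.
Qed.

(** The exponent [s + 2] is the one for which the integrand is a power of [x / (A + x)] times the
    derivative of that quotient; larger exponents are reduced to it in [integral_halfline_le]. *)
Lemma integral_powR_powRD (A s : R) : 0 < A -> -1 < s ->
  (\int[leb]_(x in `]0%R, +oo[) (x `^ s * (A + x) `^ (- (s + 2)))%:E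
    <= (A^-1 / (s + 1))%:E)%E.
Proof.
move=> A0 s1.
have Ap (x : R) : 0 < x -> 0 < A + x by move=> ?; rewrite addr_gt0.
have s10 : 0 < s + 1 by rewrite -(opprK 1) subr_gt0.
(* [g x = x / (A + x)], and [g ^ (s + 1) / (A (s + 1))] is an antiderivative. *)
pose g (x : R) := 1 - A * (A + x) `^ (-1).
pose F (x : R) := A^-1 / (s + 1) * g x `^ (s + 1).
have gE x : 0 < x -> g x = x * (A + x) `^ (-1).
  move=> x0; rewrite /g powR_inv1 ?ltW ?Ap//; field.
  by rewrite gt_eqF ?Ap.
have gp x : 0 < x -> 0 < g x.
  by move=> x0; rewrite gE// mulr_gt0// powR_gt0 ?Ap.
apply: (@ge0_integral_le_antiderivative (fun x => x `^ s * (A + x) `^ (- (s + 2))) F) => x x0.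
- have x0' := Ap _ x0.
  have d := is_derive_powRD A (-1) x x0'.
  have dg : is_derive x 1 g (A * (A + x) `^ (-1 - 1)).
    have := is_deriveB (is_derive_cst (1 : R) x 1) (is_deriveZ A d).
    rewrite sub0r /GRing.scale/=; apply: is_derive_congr => //; ring.
  have dp := is_derive1_powR (s + 1) (gp _ x0).
  have dc := @is_derive1_comp _ (@powR R ^~ (s + 1)) g x _ _ dp dg.
  have := is_deriveZ (A^-1 / (s + 1)) dc.
  rewrite /GRing.scale/=; apply: is_derive_congr => //.
  rewrite addrK gE// powRM ?ltW ?powR_gt0//.
  rewrite -powRrM mulN1r.
  have -> : - (s + 2) = - s + (-1 - 1) by ring.
  rewrite [X in _ = _ * X]powRD; last first.
    by apply/implyP => _; rewrite gt_eqF.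
  by field; rewrite !gt_eqF.
- apply: (@continuousM _ _ (@powR R ^~ s) (fun x => (A + x) `^ (- (s + 2)))).
     exact: continuous_powR_pos.
  by apply: continuous_powRD_pos; rewrite Ap.
- by rewrite mulr_ge0 ?powR_ge0.
- have c0 : 0 <= A^-1 / (s + 1) by rewrite mulr_ge0 ?invr_ge0 ?ltW.
  rewrite /F mulr_ge0 ?powR_ge0//= -[leRHS]mulr1 ler_wpM2l//.
  have := @ge0_ler_powR R (s + 1) (ltW s10) (g x) 1.
  rewrite powR1; apply; rewrite ?nnegrE ?(ltW (gp _ x0))//.
  by rewrite /g gerBl mulr_ge0 ?powR_ge0// ltW.
Qed.

Lemma powRD_pos (x r s : R) : 0 < x -> x `^ (r + s) = x `^ r * x `^ s.
Proof. by move=> x0; rewrite powRD// (gt_eqF x0) implybT. Qed.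

Lemma ler_powRN (x y r : R) : 0 < x -> x <= y -> 0 <= r -> y `^ (- r) <= x `^ (- r).
Proof.
move=> x0 xy r0; have y0 := lt_le_trans x0 xy.
rewrite !powRN lef_pV2 ?posrE ?powR_gt0//.
by apply: ge0_ler_powR; rewrite ?nnegrE// ltW.
Qed.

Lemma measurable_powR_comp d (T : measurableType d) (D : set T) (f : T -> R) (p : R) :
  measurable_fun D f -> measurable_fun D (fun x => f x `^ p).
Proof.
by move=> mf; apply: (@measurableT_comp _ _ _ _ _ _ (@powR R ^~ p)) => //;
  exact: measurable_powR.
Qed.

(** The excess [t - (s + 2)] of the exponent is paid for by [A <= A + y]. The integrand is extended
    by 0 to the whole line so that the shift [c] disappears by translation invariance. *)
Lemma integral_halfline_le (s t A c : R) : -1 < s -> s + 2 <= t -> 0 < A ->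
  (\int[leb]_y (if 0 < y - c then (y - c) `^ s * (A + (y - c)) `^ (- t) else 0)%:E
   <= (A `^ (s + 1 - t) / (s + 1))%:E)%E.
Proof.
move=> s1 st A0.
pose G (y : R) : R := if 0 < y then y `^ s * (A + y) `^ (- t) else 0.
pose H (y : R) : R := y `^ s * (A + y) `^ (- (s + 2)).
have GE : EFin \o G =
    ((fun y => (y `^ s * (A + y) `^ (- t))%:E) \_ (`]0, +oo[%classic : set R)).
  apply/funext => y; rewrite /G /= patchE mem_setE/= in_itv/= andbT.
  by case: ifP.
have mp u v : measurable_fun setT (fun y : R => y `^ u * (A + y) `^ v).
  apply: measurable_funM; first exact: measurable_powR.
  by apply: measurable_powR_comp; exact: measurable_funD.
have mG : measurable_fun setT (EFin \o G).
  rewrite GE; apply/(measurable_restrictT _ _).1 => //.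
  by apply: measurable_funTS; apply/measurable_EFinP.
have G0 y : (0 <= (EFin \o G) y)%E.
  by rewrite /= lee_fin /G; case: ifP => // _; rewrite mulr_ge0 ?powR_ge0.
have := ge0_integral_shift c _ mG G0; rewrite {1}/G /= => ->.
rewrite -[X in (integral _ _ X <= _)%E]/(EFin \o G) GE -integral_mkcond.
have At : 0 <= t - (s + 2) by rewrite subr_ge0.
apply: (@le_trans _ _ (\int[leb]_(y in `]0%R, +oo[)
    ((A `^ (- (t - (s + 2))))%:E * (H y)%:E))%E).
  apply: ge0_le_integral => //.
  - by move=> y _; rewrite lee_fin mulr_ge0 ?powR_ge0.
  - apply: measurable_funTS; apply/measurable_EFinP; exact: (mp s (- t)).
  - apply: measurable_funTS; apply: measurable_funeM => //.
    apply/measurable_EFinP; exact: (mp s (- (s + 2))).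
  move=> y; rewrite /= in_itv/= andbT => y0.
  rewrite -EFinM lee_fin /H mulrCA ler_wpM2l ?powR_ge0//.
  have Ay : 0 < A + y by rewrite addr_gt0.
  have -> : - t = - (t - (s + 2)) + (- (s + 2)) by ring.
  rewrite powRD_pos// ler_wpM2r ?powR_ge0// ler_powRN//.
  by rewrite lerDl ltW.
rewrite ge0_integralZl//; last 3 first.
- apply: measurable_funTS; apply/measurable_EFinP; exact: (mp s (- (s + 2))).
- by move=> y _; rewrite lee_fin mulr_ge0 ?powR_ge0.
- by rewrite lee_fin powR_ge0.
apply: (@le_trans _ _ ((A `^ (- (t - (s + 2))))%:E * (A^-1 / (s + 1))%:E)%E).
  by apply: lee_wpmul2l; [rewrite lee_fin powR_ge0|exact: integral_powR_powRD].
rewrite -EFinM lee_fin mulrA -powR_inv1 ?(ltW A0)// -powRD_pos//.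
by have -> : - (t - (s + 2)) + -1 = s + 1 - t by ring.
Qed.

Lemma integral_line_le (q A c : R) : 1 < q -> 0 < A ->
  (\int[leb]_x ((A + `|x - c|) `^ (- q))%:E <= (2 * (A `^ (1 - q) / (q - 1)))%:E)%E.
Proof.
move=> q1 A0; have := integral_powRD_norm A q A0 q1.
rewrite -(ge0_integral_shift c (fun x => ((A + `|x|) `^ (- q))%:E))//.
- apply/measurable_EFinP; apply: measurable_powR_comp.
  by apply: measurable_funD => //; exact: normr_measurable.
- by move=> x; rewrite lee_fin powR_ge0.
Qed.

(** With [B] the square root of [A], [(B + |x - c|)^2 <= 2 (A + (x - c)^2)]; this reduces the claim
    to [integral_line_le] with exponent [2 m] and costs the factor [2 ^ m]. *)
Lemma integral_line_sqr_le (m A c : R) : 1 / 2 < m -> 0 < A ->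
  (\int[leb]_x ((A + (x - c) ^+ 2) `^ (- m))%:E
   <= (2 `^ m * (2 / (2 * m - 1)) * A `^ (1 / 2 - m))%:E)%E.
Proof.
move=> m1 A0; set B := Num.sqrt A.
have B0 : 0 < B by rewrite sqrtr_gt0.
have AE : A = B ^+ 2 by rewrite sqr_sqrtr// ltW.
apply: (@le_trans _ _ (\int[leb]_x ((2 `^ m)%:E * ((B + `|x - c|) `^ (- (2 * m)))%:E))%E).
  apply: ge0_le_integral => //.
  - by move=> x _; rewrite lee_fin powR_ge0.
  - apply/measurable_EFinP; apply: measurable_powR_comp.
    apply: measurable_funD => //; apply: measurable_funX.
    exact: measurable_shift.
  - apply: measurable_funeM; apply/measurable_EFinP.
    apply: measurable_powR_comp; apply: measurable_funD => //.
    by apply: measurableT_comp; [exact: normr_measurable|exact: measurable_shift].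
  move=> x _; rewrite -EFinM lee_fin.
  have Bx : 0 < B + `|x - c| by rewrite ltr_wpDr.
  rewrite -[2 `^ m]invrK -powRN.
  have -> : (2 `^ (- m))^-1 * (B + `|x - c|) `^ (- (2 * m)) =
      (2^-1 * (B + `|x - c|) ^+ 2) `^ (- m).
    rewrite -mulrN powRM ?invr_ge0 ?sqr_ge0// -powR_mulrn ?(ltW Bx)// -powRrM.
    rewrite -[in RHS](@powR_inv1 R 2)// -powRrM mulN1r opprK powRN invrK.
    by rewrite -[2%:R in RHS]/(2 : R) ?mulrN.
  apply: ler_powRN.
  - by rewrite mulr_gt0 ?invr_gt0// exprn_gt0.
  - rewrite AE -(real_normK (num_real (x - c))).
    have := sqr_ge0 (B - `|x - c|); rewrite sqrrB sqrrD.
    set u := B ^+ 2; set v := `|x - c| ^+ 2; set w := B * _; lra.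
  - lra.
rewrite ge0_integralZl//; last 2 first.
- apply/measurable_EFinP; apply: measurable_powR_comp.
  apply: measurable_funD => //.
  by apply: measurableT_comp; [exact: normr_measurable|exact: measurable_shift].
- by move=> y _; rewrite lee_fin powR_ge0.
rewrite -mulrA EFinM; apply: lee_wpmul2l; first by rewrite lee_fin powR_ge0.
apply: (le_trans (integral_line_le _ _ c _ B0)); first lra.
rewrite lee_fin AE -powR_mulrn ?(ltW B0)// -powRrM.
have -> : 2%:R * (1 / 2 - m) = 1 - 2 * m by field.
rewrite le_eqVlt; apply/orP; left; apply/eqP; field; lra.
Qed.

End OneDim.

(** * Integration on R^k *)

Section RnIntegral.
Context {R : realType}.
Local Notation leb := (@lebesgue_measure R).
Local Notation E k := (rn_T R (Rn R k)).
Local Notation mu k := (rn_mu R (Rn R k)).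

Lemma measurable_coord k i : measurable_fun [set: E k] (fun v => Defs.coord R k v i).
Proof.
elim: k i => [|k IH] [|i] //=.
- exact: measurable_fst.
- exact: (measurableT_comp (IH i) measurable_snd).
Qed.

Lemma integral_Rn_recl k (F : E k.+1 -> \bar R) :
  measurable_fun setT F -> (forall v, 0 <= F v)%E ->
  (\int[mu k.+1]_v F v = \int[leb]_x \int[mu k]_v F (x, v))%E.
Proof. move=> mF F0; exact: (@fubini_tonelli1 _ _ _ _ R leb (mu k) F mF F0). Qed.

Lemma Rn_integral_ge0 k (F : E k -> \bar R) :
  (forall v, 0 <= F v)%E -> (0 <= \int[mu k]_v F v)%E.
Proof. by move=> F0; exact: integral_ge0. Qed.

Lemma measurable_Rn_section k (F : E k.+1 -> \bar R) (x : R) :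
  measurable_fun setT F -> measurable_fun setT (fun v : E k => F (x, v)).
Proof. move=> mF; exact: (measurableT_comp mF (pair1_measurable x)). Qed.

Lemma measurable_Rn_integral k (F : E k.+1 -> \bar R) :
  measurable_fun setT F -> (forall v, 0 <= F v)%E ->
  measurable_fun setT (fun x : measurableTypeR R => \int[mu k]_v F (x, v))%E.
Proof.
move=> mF F0.
exact: (@measurable_fun_fubini_tonelli_F _ _ _ _ R (mu k) F mF F0).
Qed.

Lemma mkseq_coord k m x (v : E m) :
  mkseq (Defs.coord R m.+1 (x, v)) k.+1 = x :: mkseq (Defs.coord R m v) k.
Proof. by rewrite /mkseq /= -[1%N]addn0 iotaDl -map_comp. Qed.

Lemma integral_Rn0 (G : E 0 -> \bar R) : measurable_fun setT G ->
  (\int[mu 0]_v G v = G tt)%E.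
Proof.
move=> mG; rewrite -[LHS]/(\int[@dirac _ unit tt R]_v G v)%E.
by rewrite integral_dirac// diracT mul1e.
Qed.

(* The two innermost coordinates carry the singular weight, shifted by quantities that
   depend on the other coordinates; each of the remaining [k] coordinates then costs a
   factor [A ^ (1 / 2)].  The shifts [phi] and [psi] need not be measurable. *)
Lemma integral_Rn_le (s t : R) k : -1 < s -> s + 2 + k%:R / 2 < t ->
  exists2 C : R, 0 < C &
  forall (A : R) (w : nat -> R) (phi psi : seq R -> R) (F : E k.+2 -> \bar R),
  0 < A -> measurable_fun setT F -> (forall v, 0 <= F v)%E ->
  (forall v, let r := Defs.coord R _ v k.+1 - psi (mkseq (Defs.coord R _ v) k) in
     (F v <= (if (0 < r)%R then
       r `^ s * (A + \sum_(i < k) (Defs.coord R _ v i - w i) ^+ 2 + r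
         + `|Defs.coord R _ v k - phi (mkseq (Defs.coord R _ v) k)|) `^ (- t) else 0)%:E)%E) ->
  (\int[mu k.+2]_v F v <= (C * A `^ (s + 2 + k%:R / 2 - t))%:E)%E.
Proof.
move=> s1; elim: k => [|k IH] st.
  have st' : s + 2 < t by move: st; rewrite mul0r addr0.
  exists (2 / ((t - s - 2) * (s + 1))).
    by rewrite divr_gt0// mulr_gt0//; lra.
  move=> A w phi psi F A0 mF F0 Fle.
  rewrite integral_Rn_recl//.
  (* With no outer coordinates the shifts are constants. The weighted coordinate is integrated
     first, over its half-line, and leaves the exponent [t - s - 1 > 1] for the other one. *)
  set ph := phi [::]; set ps := psi [::].
  have inner x : (\int[mu 1]_v F (x, v) <=
      ((s + 1)^-1)%:E * ((A + `|x - ph|) `^ (- (t - s - 1)))%:E)%E.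
    have mFx := measurable_Rn_section _ _ x mF.
    rewrite (integral_Rn_recl 0 (fun v => F (x, v)))//.
    have Ax : 0 < A + `|x - ph| by rewrite ltr_wpDr.
    apply: (@le_trans _ _ (((A + `|x - ph|) `^ (s + 1 - t) / (s + 1))%:E)); last first.
      rewrite -EFinM lee_fin mulrC.
      by have -> : - (t - s - 1) = s + 1 - t by ring.
    apply: le_trans (integral_halfline_le s t (A + `|x - ph|) ps s1 (ltW st') Ax).
    apply: ge0_le_integral => //.
    - by move=> y _; apply: Rn_integral_ge0 => v; exact: F0.
    - exact: (measurable_Rn_integral 0 (fun v => F (x, v))).
    - apply/measurable_EFinP; apply: measurable_fun_ifT.
      + by apply: measurable_fun_ltr => //; exact: measurable_shift.
      + apply: measurable_funM; apply: measurable_powR_comp.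
          exact: measurable_shift.
        by apply: measurable_funD => //; exact: measurable_shift.
      + exact: measurable_cst.
    move=> y _.
    rewrite (integral_Rn0 (fun v => F (x, (y, v)))); last first.
      exact: (measurable_Rn_section 0 (fun v : E 1 => F (x, v)) y mFx).
    apply: (le_trans (Fle (x, (y, tt)))) => /=.
    rewrite big_ord0 addr0 /mkseq /= -/ph -/ps.
    by rewrite [A + _ + `|_|]addrAC.
  apply: (@le_trans _ _ (\int[leb]_x
      (((s + 1)^-1)%:E * ((A + `|x - ph|) `^ (- (t - s - 1)))%:E))%E).
    apply: ge0_le_integral => //.
    - by move=> x _; apply: Rn_integral_ge0 => v; exact: F0.
    - exact: measurable_Rn_integral.
    - apply: measurable_funeM; apply/measurable_EFinP; apply: measurable_powR_comp.
      apply: measurable_funD => //.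
      by apply: measurableT_comp; [exact: normr_measurable|exact: measurable_shift].
  have s10 : 0 < s + 1 by lra.
  rewrite ge0_integralZl//; last 3 first.
  - apply/measurable_EFinP; apply: measurable_powR_comp.
    apply: measurable_funD => //.
    by apply: measurableT_comp; [exact: normr_measurable|exact: measurable_shift].
  - by move=> y _; rewrite lee_fin powR_ge0.
  - by rewrite lee_fin invr_ge0 ltW.
  apply: (@le_trans _ _ (((s + 1)^-1)%:E *
    (2 * (A `^ (1 - (t - s - 1)) / (t - s - 1 - 1)))%:E)%E).
    apply: lee_wpmul2l; first by rewrite lee_fin invr_ge0 ltW.
    by apply: integral_line_le => //; lra.
  rewrite -EFinM lee_fin mul0r addr0.
  have -> : 1 - (t - s - 1) = s + 2 - t by ring.
  rewrite le_eqVlt; apply/orP; left; apply/eqP; field.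
  by rewrite !gt_eqF//; lra.
have stk : s + 2 + k%:R / 2 < t by move: st; rewrite -[k.+1%:R]natr1; lra.
have [C C0 HC] := IH stk.
(* The induction hypothesis leaves the power [- m] of its parameter; [1 / 2 < m] is what the
   integral over one more squared coordinate requires. *)
pose m := t - (s + 2 + k%:R / 2).
have m1 : 1 / 2 < m by move: st; rewrite /m -[k.+1%:R]natr1; lra.
exists (C * (2 `^ m * (2 / (2 * m - 1)))).
  by rewrite !mulr_gt0 ?powR_gt0 ?invr_gt0//; lra.
move=> A w phi psi F A0 mF F0 Fle.
rewrite integral_Rn_recl//.
apply: (@le_trans _ _ (\int[leb]_x (C%:E * ((A + (x - w 0%N) ^+ 2) `^ (- m))%:E))%E).
  apply: ge0_le_integral => //.
  - by move=> x _; apply: Rn_integral_ge0 => v; exact: F0.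
  - exact: measurable_Rn_integral.
  - apply: measurable_funeM; apply/measurable_EFinP; apply: measurable_powR_comp.
    apply: measurable_funD => //; apply: measurable_funX; exact: measurable_shift.
  move=> x _.
  have mE : - m = s + 2 + k%:R / 2 - t by rewrite /m; ring.
  rewrite -EFinM mE.
  apply: (HC _ (fun i => w i.+1) (fun q => phi (x :: q)) (fun q => psi (x :: q))).
  - by rewrite ltr_wpDr ?sqr_ge0.
  - exact: measurable_Rn_section.
  - by move=> v.
  move=> v; apply: (le_trans (Fle (x, v))).
  rewrite mkseq_coord big_ord_recl /=.
  by rewrite -!addrA.
rewrite ge0_integralZl//; last 3 first.
- apply/measurable_EFinP; apply: measurable_powR_comp.
  apply: measurable_funD => //; apply: measurable_funX; exact: measurable_shift.
- by move=> y _; rewrite lee_fin powR_ge0.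
- by rewrite lee_fin ltW.
apply: (@le_trans _ _ (C%:E * (2 `^ m * (2 / (2 * m - 1)) * A `^ (1 / 2 - m))%:E)%E).
  apply: lee_wpmul2l; first by rewrite lee_fin ltW.
  exact: integral_line_sqr_le.
rewrite -EFinM lee_fin !mulrA.
by have -> : 1 / 2 - m = s + 2 + k.+1%:R / 2 - t by rewrite /m -[k.+1%:R]natr1; field.
Qed.

Lemma integral_indic_itv (a b : R) (x y : bool) : a <= b ->
  (\int[leb]_u (\1_([set` Interval (BSide x a) (BSide y b)] : set R) u)%:E
   = (b - a)%:E)%E.
Proof.
move=> ab; transitivity (leb [set` Interval (BSide x a) (BSide y b)]).
  by rewrite integral_indic// setIT.
rewrite lebesgue_measure_itv/= lte_fin; case: ltP => h; first by rewrite EFinB.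
by have -> : b - a = 0 by lra.
Qed.

Lemma measure_Rn_recl k (B : set (E k.+1)) :
  mu k.+1 B = (\int[leb]_x mu k (xsection B x))%E.
Proof. by []. Qed.

Lemma xsectionE (T1 T2 : Type) (A : set (T1 * T2)) x y : xsection A x y = A (x, y).
Proof. by rewrite /xsection /mkset; apply/propext; rewrite inE. Qed.

Lemma integral_cst_indic_itv (c l : R) : 0 <= l ->
  (\int[leb]_x (c * \1_(`[- l, l]%classic : set R) x)%:E = (c * (2 * l))%:E)%E.
Proof.
move=> l0; have ll : - l <= l by lra.
rewrite EFinM; under eq_integral do rewrite EFinM.
rewrite integralZl//; last first.
  apply/integrableP; split; first by apply/measurable_EFinP.
  under eq_integral do rewrite /= ger0_norm//.
  by rewrite integral_indic_itv// ltry.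
by rewrite integral_indic_itv//; congr (_ * _%:E)%E; ring.
Qed.

(** A product of intervals sheared in its last coordinate by a function of the first [k]. The last
    interval is half-open so that boxes at consecutive dyadic heights are disjoint. *)
Definition in_box k (l l' r1 r2 : R) (psi : seq R -> R) (c : nat -> R) : Prop :=
  [/\ forall i, (i < k)%N -> `|c i| <= l, `|c k| <= l' &
      r1 < c k.+1 - psi (mkseq c k) <= r2].

Lemma in_boxS k l l' r1 r2 psi K x (v : E K) :
  in_box k.+1 l l' r1 r2 psi (Defs.coord R K.+1 (x, v)) <->
  `|x| <= l /\ in_box k l l' r1 r2 (fun q => psi (x :: q)) (Defs.coord R K v).
Proof.
rewrite /in_box mkseq_coord; split=> [[h1 h2 h3]|[xl [h1 h2 h3]]].
  split; first exact: (h1 0%N).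
  by split=> // i ik; exact: (h1 i.+1).
by split=> // -[|i] ik; [exact: xl|exact: h1].
Qed.

(** Freezing the outer coordinate changes the shear, so the induction hypothesis has to hold for
    every [psi]. *)
Lemma measure_Rn_boxS K k (l l' r1 r2 c : R) : 0 <= l ->
  (forall psi (B : set (E K)), measurable B ->
    (forall v, B v <-> in_box k l l' r1 r2 psi (Defs.coord R K v)) ->
    mu K B = c%:E) ->
  forall psi (B : set (E K.+1)), measurable B ->
    (forall v, B v <-> in_box k.+1 l l' r1 r2 psi (Defs.coord R K.+1 v)) ->
    mu K.+1 B = (c * (2 * l))%:E.
Proof.
move=> l0 IH psi B mB BE; rewrite measure_Rn_recl -integral_cst_indic_itv//.
apply: eq_integral => x _; rewrite indicE mem_setE.
have -> : (x \in `[- l, l]) = (`|x| <= l) by rewrite in_itv/= ler_norml.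
have [xl|xl] := boolP (`|x| <= _); last first.
  rewrite mulr0 (_ : xsection B x = set0) ?measure0// -subset0 => u.
  rewrite xsectionE => /BE/in_boxS[h _].
  by rewrite h in xl.
rewrite mulr1; apply: (IH (fun q => psi (x :: q))).
  exact: measurable_xsection.
move=> v; rewrite xsectionE; split; first by move=> /BE/in_boxS[].
by move=> h; apply/BE/in_boxS.
Qed.

(** Cavalieri: the shear translates each fibre of the last coordinate, so the volume is that of the
    unsheared box, whatever [psi] is. *)
Lemma measure_Rn_box k (l l' r1 r2 : R) (psi : seq R -> R) (B : set (E k.+2)) :
  0 <= l -> 0 <= l' -> r1 < r2 -> measurable B ->
  (forall v, B v <-> in_box k l l' r1 r2 psi (Defs.coord R _ v)) ->
  mu k.+2 B = ((2 * l) ^+ k * (2 * l') * (r2 - r1))%:E.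
Proof.
move=> l0 l'0 r12; elim: k psi B => [|k IH] psi B mB BE; last first.
  rewrite (measure_Rn_boxS _ _ _ _ _ _ _ l0 IH psi)//.
  by congr EFin; rewrite exprSr; ring.
rewrite -[LHS]/(\int[leb]_x (mu 1 (xsection B x)))%E.
rewrite expr0 mul1r mulrC -integral_cst_indic_itv//.
apply: eq_integral => x _.
rewrite -[LHS]/(\int[leb]_y (mu 0 (xsection (xsection B x) y)))%E indicE mem_setE.
have hx : (x \in `[- l', l']) = (`|x| <= l') by rewrite in_itv/= ler_norml.
rewrite hx; have [xl|xl] := boolP (`|x| <= _); last first.
  rewrite mulr0 integral0_eq// => y _.
  rewrite (_ : xsection (xsection B x) y = set0) ?measure0// -subset0 => u.
  rewrite !xsectionE => /BE[_ /= h _].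
  by rewrite h in xl.
rewrite mulr1; transitivity
  (\int[leb]_y (\1_(`]psi [::] + r1, psi [::] + r2]%classic : set R) y)%:E)%E.
  apply: eq_integral => y _.
  rewrite -[LHS]/(\d_tt (xsection (xsection B x) y)) diracE indicE; congr (_%:R%:E).
  congr (nat_of_bool _); apply/idP/idP => [|].
    rewrite inE !xsectionE => /BE[_ _ /= h].
    by rewrite inE/= in_itv/=; move: h; rewrite /mkseq/=; lra.
  rewrite inE/= in_itv/= => h.
  rewrite inE !xsectionE; apply/BE; split => //=.
  by rewrite /mkseq/=; lra.
by rewrite integral_indic_itv ?lerD2l ?(ltW r12)//; congr EFin; ring.
Qed.

End RnIntegral.

(** * The kernels *)

Section ComplexFacts.
Context {R : realType}.
Implicit Types (x y : R[i]).

Lemma cRe_mul x y : complex.Re (x * y) =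
  complex.Re x * complex.Re y - complex.Im x * complex.Im y.
Proof. by case: x => a b; case: y => c d. Qed.

Lemma cIm_mul x y : complex.Im (x * y) =
  complex.Re x * complex.Im y + complex.Im x * complex.Re y.
Proof. by case: x => a b; case: y => c d. Qed.

Lemma cmodE x : cmod R x = ComplexField.Normc.normc x.
Proof. by case: x. Qed.

Lemma cmodM x y : cmod R (x * y) = cmod R x * cmod R y.
Proof. by rewrite !cmodE ComplexField.Normc.normcM. Qed.

Lemma cmodV x : cmod R x^-1 = (cmod R x)^-1.
Proof. by rewrite !cmodE ComplexField.Normc.normcV. Qed.

Lemma cmod_ge0 x : 0 <= cmod R x.
Proof. exact: sqrtr_ge0. Qed.

Lemma cmod_real (r : R) : cmod R (r%:C)%C = `|r|.
Proof. by rewrite /cmod /= expr0n addr0 sqrtr_sqr. Qed.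

Lemma ler_Re_cmod x : `|complex.Re x| <= cmod R x.
Proof. by rewrite /cmod -sqrtr_sqr ler_wsqrtr// lerDl sqr_ge0. Qed.

Lemma ler_Im_cmod x : `|complex.Im x| <= cmod R x.
Proof. by rewrite /cmod -sqrtr_sqr ler_wsqrtr// lerDr sqr_ge0. Qed.

Lemma cmod_le_ReIm x : cmod R x <= `|complex.Re x| + `|complex.Im x|.
Proof.
rewrite /cmod -[leRHS]ger0_norm ?addr_ge0// -sqrtr_sqr ler_wsqrtr//.
rewrite sqrrD !real_normK ?num_real// -addrA lerD2l lerDr.
by rewrite mulrn_wge0// mulr_ge0.
Qed.

Lemma cmod_cpow x c : cmod R (cpow R x c) = cmod R x `^ c.
Proof.
rewrite {1}/cmod /cpow /= !exprMn -mulrDr cos2Dsin2 mulr1 sqrtr_sqr.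
by rewrite ger0_norm// powR_ge0.
Qed.

Lemma invCE (a b : R) : (Complex a b)^-1 =
  Complex (a / (a ^+ 2 + b ^+ 2)) (- (b / (a ^+ 2 + b ^+ 2))).
Proof. by []. Qed.

Lemma Complex_eq (a b c d : R) : a = c -> b = d -> Complex a b = Complex c d.
Proof. by move=> -> ->. Qed.

Lemma Complex_sqr (a b : R) : (Complex a b) ^+ 2 = Complex (a ^+ 2 - b ^+ 2) (2 * (a * b)).
Proof.
rewrite expr2; apply/eqP; rewrite eq_complex cRe_mul cIm_mul /=.
by apply/andP; split; apply/eqP; ring.
Qed.

Lemma Complex_subJ (a b c d : R) :
  Complex a b - (Complex c d)^*%C = Complex (a - c) (b + d).
Proof.
by apply/eqP; rewrite eq_complex /= opprK !eqxx.
Qed.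

Lemma cpowV x c : 0 < cmod R x -> (cpow R x c)^-1 =
  Complex (cmod R x `^ (- c) * cos (c * Arg R x))
          (- (cmod R x `^ (- c) * sin (c * Arg R x))).
Proof.
move=> x0; have m0 := powR_gt0 c x0.
rewrite powRN /cpow invCE !exprMn -mulrDr cos2Dsin2 mulr1.
by apply: Complex_eq; field; rewrite gt_eqF.
Qed.

Lemma sum_Complex m (f g : 'I_m -> R) :
  \sum_(j < m) Complex (f j) (g j) = Complex (\sum_(j < m) f j) (\sum_(j < m) g j).
Proof. by elim/big_rec3 : _ => // i a b c _ ->. Qed.

(** The product has argument [-(c1 Arg x + c2 Arg y)]. Small slopes [Im / Re] make this so small
    that its cosine exceeds one half. *)
Lemma nearly_real_kernel (c1 c2 : R) : exists2 d : R, 0 < d &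
  forall x y : R[i], 0 < complex.Re x -> 0 < complex.Re y ->
  `|complex.Im x| <= d * complex.Re x -> `|complex.Im y| <= d * complex.Re y ->
  2^-1 * (cmod R x `^ (- c1) * cmod R y `^ (- c2)) <=
  complex.Re ((cpow R x c1)^-1 * (cpow R y c2)^-1).
Proof.
have [e e0 he] : exists2 e : R, 0 < e & forall t : R, `|t| < e -> 2^-1 < cos t.
  have : \forall t \near (0 : R), 2^-1 < cos t.
    have H : (cos t : R) @[t --> (0 : R)] --> (1 : R).
      by rewrite -[X in _ --> X](@cos0 R); exact: continuous_cos.
    by apply: (cvgr_gt _ H); lra.
  move=> /nbhs_ballP[e /= e0 H]; exists e => // t te; apply: H.
  by rewrite /ball/= sub0r normrN.
(* The summand 1 keeps [M] positive when both exponents vanish; two angles below [e / M] then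
   combine to less than [e]. *)
pose M := `|c1| + `|c2| + 1.
have M0 : 0 < M by rewrite ltr_wpDl// addr_ge0.
have [d d0 hd] : exists2 d : R, 0 < d & forall t : R, `|t| < d -> `|atan t| < e / M.
  have eM : 0 < e / M by rewrite divr_gt0.
  have : \forall t \near (0 : R), `|atan t| < e / M.
    have H : (atan t : R) @[t --> (0 : R)] --> (0 : R).
      by rewrite -[X in _ --> X](@atan0 R); exact: continuous_atan.
    exact: (cvgr0_norm_lt _ H).
  move=> /nbhs_ballP[d /= d0 H]; exists d => // t td; apply: H.
  by rewrite /ball/= sub0r normrN.
(* Halving turns the weak hypotheses on the imaginary parts into the strict inequality that [hd]
   asks for. *)
exists (d / 2); first by rewrite divr_gt0.
have Ad x : 0 < complex.Re x -> `|complex.Im x| <= d / 2 * complex.Re x ->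
    `|Arg R x| < e / M.
  move=> x0 hx; rewrite /Arg x0; apply: hd.
  rewrite normrM normfV [`|complex.Re x|]gtr0_norm// ltr_pdivrMr//.
  by apply: (le_lt_trans hx); rewrite ltr_pM2r//; lra.
move=> x y x0 y0 hx hy.
have cm u : 0 < complex.Re u -> 0 < cmod R u.
  by move=> u0; apply: lt_le_trans (ler_Re_cmod _); rewrite normr_gt0 gt_eqF.
rewrite !cpowV ?cm// cRe_mul /=.
set p := cmod R x `^ _; set q := cmod R y `^ _.
have -> : p * cos (c1 * Arg R x) * (q * cos (c2 * Arg R y)) -
    - (p * sin (c1 * Arg R x)) * - (q * sin (c2 * Arg R y)) =
    cos (c1 * Arg R x + c2 * Arg R y) * (p * q) by rewrite cosD; ring.
rewrite ler_wpM2r ?mulr_ge0 ?powR_ge0//; apply: ltW; apply: he.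
apply: (le_lt_trans (ler_normD _ _)); rewrite !normrM.
apply: (@le_lt_trans _ _ (`|c1| * (e / M) + `|c2| * (e / M))).
  by rewrite lerD// ler_wpM2l// ltW// Ad.
rewrite -mulrDl mulrCA -{2}[e]mulr1 ltr_pM2l// ltr_pdivrMr// mul1r /M.
by rewrite ltrDl.
Qed.

End ComplexFacts.

(** * The function [rho(z,u)] in real coordinates, and what the two kernels have in common *)

Section Rho.
Context {R : realType}.
Variable m : nat.
Local Notation n := m.+1.
Local Notation k := (2 * m)%N.
Local Notation co := (Defs.coord R (2 * n)).
Implicit Types (z u w e : Cn R n).

Definition sqdist z u : R :=
  \sum_(j < m) ((xc R n z j - xc R n u j) ^+ 2 + (yc R n z j - yc R n u j) ^+ 2).

(** Twice the imaginary part of [rho(z,u)], written as the last real part of [u] minus an expression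
    free of it: for the integration in [u] this is a translated coordinate. *)
Definition twist z u : R :=
  xc R n u m - (xc R n z m -
    \sum_(j < m) (xc R n z j - xc R n u j) * (yc R n z j + yc R n u j)).

(** In the real part [- (y + t)^2 = (y - t)^2 - 2 y^2 - 2 t^2] for each coordinate of [z'] and [u'];
    the last two terms complete [2 y_n] and [2 t_n] to [2 rho(z)] and [2 rho(u)]. *)
Lemma rho2E z u : rho2 R n z u =
  Complex ((sqdist z u + 2 * rho R n z + 2 * rho R n u) / 4) (twist z u / 2).
Proof.
rewrite /rho2 /=.
have -> : \sum_(j < m) (zc R n z j - (zc R n u j)^*%C) ^+ 2 =
  Complex (\sum_(j < m) ((xc R n z j - xc R n u j) ^+ 2 - (yc R n z j + yc R n u j) ^+ 2))
   (\sum_(j < m) (2 * ((xc R n z j - xc R n u j) * (yc R n z j + yc R n u j)))).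
  rewrite -sum_Complex; apply: eq_bigr => j _.
  by rewrite /zc Complex_subJ Complex_sqr.
rewrite /zc Complex_subJ.
have -> : forall a b p q : R, Complex p q - (2 : R)%:C%C * 'i%C *
    Complex a b = Complex (p + 2 * b) (q - 2 * a).
  move=> a b p q; apply/eqP; rewrite eq_complex/=.
  by apply/andP; split; apply/eqP; ring.
apply/eqP; rewrite eq_complex/=; apply/andP; split; apply/eqP; last first.
  by rewrite mul0r addr0 /twist -mulr_sumr; field.
rewrite mul0r subr0 /sqdist /rho /= mulrC mul1r; congr (_ * _).
have -> : \sum_(j < m) ((xc R n z j - xc R n u j) ^+ 2 - (yc R n z j + yc R n u j) ^+ 2)
  = \sum_(j < m) ((xc R n z j - xc R n u j) ^+ 2 + (yc R n z j - yc R n u j) ^+ 2)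
    - 2 * \sum_(j < m) yc R n z j ^+ 2 - 2 * \sum_(j < m) yc R n u j ^+ 2.
  rewrite !mulr_sumr -!sumrB; apply: eq_bigr => j _; ring.
ring.
Qed.

Lemma Re_rho2 z u : complex.Re (rho2 R n z u) =
  (sqdist z u + 2 * rho R n z + 2 * rho R n u) / 4.
Proof. by rewrite rho2E. Qed.

Lemma Im_rho2 z u : complex.Im (rho2 R n z u) = twist z u / 2.
Proof. by rewrite rho2E. Qed.

Lemma sqdist_ge0 z u : 0 <= sqdist z u.
Proof. by apply: sumr_ge0 => j _; rewrite addr_ge0 ?sqr_ge0. Qed.

Lemma Re_rho2_gt0 z u : TB R n z -> TB R n u -> 0 < complex.Re (rho2 R n z u).
Proof.
rewrite /TB/= => z0 u0; rewrite Re_rho2.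
by have := sqdist_ge0 z u; lra.
Qed.

Lemma cmod_rho2_gt0 z u : TB R n z -> TB R n u -> 0 < cmod R (rho2 R n z u).
Proof.
move=> hz hu; apply: lt_le_trans (ler_Re_cmod _).
by rewrite normr_gt0 gt_eqF// Re_rho2_gt0.
Qed.

Lemma rho_le_cmod z u : TB R n z -> TB R n u -> rho R n z <= 2 * cmod R (rho2 R n z u).
Proof.
move=> hz hu; have := ler_Re_cmod (rho2 R n z u).
rewrite gtr0_norm ?Re_rho2_gt0// Re_rho2; have := sqdist_ge0 z u.
move: hz hu; rewrite /TB/=; lra.
Qed.

Lemma rho_le_cmodr z u : TB R n z -> TB R n u -> rho R n u <= 2 * cmod R (rho2 R n z u).
Proof.
move=> hz hu; have := ler_Re_cmod (rho2 R n z u).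
rewrite gtr0_norm ?Re_rho2_gt0// Re_rho2; have := sqdist_ge0 z u.
move: hz hu; rewrite /TB/=; lra.
Qed.

(** The modulus is at least the mean of the real part and the absolute imaginary part. The sum on
    the left has the shape required by [integral_Rn_le]. *)
Lemma cmod_rho2_ge z u : TB R n z -> TB R n u ->
  8^-1 * (rho R n z + sqdist z u + rho R n u + `|twist z u|) <= cmod R (rho2 R n z u).
Proof.
move=> hz hu; have := ler_Re_cmod (rho2 R n z u); have := ler_Im_cmod (rho2 R n z u).
rewrite (gtr0_norm (Re_rho2_gt0 _ _ hz hu)) Re_rho2 Im_rho2 normrM.
rewrite [`|2^-1|]gtr0_norm ?invr_gt0//.
have := sqdist_ge0 z u; move: hz hu; rewrite /TB/=; lra.
Qed.

Lemma measurable_xc j : measurable_fun setT (fun z : Cn R n => xc R n z j).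
Proof. exact: measurable_coord. Qed.

Lemma measurable_yc j : measurable_fun setT (fun z : Cn R n => yc R n z j).
Proof. exact: measurable_coord. Qed.

Lemma measurable_rho : measurable_fun setT (rho R n).
Proof.
apply: measurable_funB; first exact: measurable_yc.
apply: measurable_sum => j; apply: measurable_funX; exact: measurable_yc.
Qed.

Lemma measurable_TB : measurable (TB R n).
Proof.
rewrite /TB -[X in measurable X]setTI.
by apply: measurable_fun_ltr => //; exact: measurable_rho.
Qed.

Lemma measurable_sqdist z : measurable_fun setT (sqdist z).
Proof.
apply: measurable_sum => j; apply: measurable_funD; apply: measurable_funX;
  apply: measurable_funB => //; [exact: measurable_xc|exact: measurable_yc].
Qed.

Lemma measurable_twist z : measurable_fun setT (twist z).
Proof.
apply: measurable_funB; first exact: measurable_xc.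
apply: measurable_funB => //; apply: measurable_sum => j; apply: measurable_funM.
  by apply: measurable_funB => //; exact: measurable_xc.
by apply: measurable_funD => //; exact: measurable_yc.
Qed.

Lemma measurable_Re_rho2 z : measurable_fun setT (fun u => complex.Re (rho2 R n z u)).
Proof.
under eq_fun do rewrite Re_rho2.
apply: measurable_funM => //; apply: measurable_funD.
  by apply: measurable_funD => //; exact: measurable_sqdist.
by apply: measurable_funM => //; exact: measurable_rho.
Qed.

Lemma measurable_Im_rho2 z : measurable_fun setT (fun u => complex.Im (rho2 R n z u)).
Proof.
under eq_fun do rewrite Im_rho2.
apply: measurable_funM => //; exact: measurable_twist.
Qed.

Lemma measurable_cmod d (T : measurableType d) (D : set T) (f : T -> R[i]) :
  measurable_fun D (fun x => complex.Re (f x)) ->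
  measurable_fun D (fun x => complex.Im (f x)) ->
  measurable_fun D (fun x => cmod R (f x)).
Proof.
move=> mr mi; rewrite /cmod.
under eq_fun do rewrite -powR12_sqrt ?addr_ge0 ?sqr_ge0//.
by apply: measurable_powR_comp; apply: measurable_funD; apply: measurable_funX.
Qed.

Lemma measurable_Sker z c : measurable_fun setT (fun u => complex.Re (Sker R n z u c)).
Proof.
rewrite /Sker /=; under eq_fun do rewrite -powRN.
apply: measurable_powR_comp; apply: measurable_cmod.
  exact: measurable_Re_rho2.
exact: measurable_Im_rho2.
Qed.

Lemma measurable_Tker z c : TB R n z ->
  measurable_fun (TB R n) (fun u => complex.Re (Tker R n z u c)) /\
  measurable_fun (TB R n) (fun u => complex.Im (Tker R n z u c)).
Proof.
move=> hz.
(* On [T_B] the real part is positive, so [Arg] is given by its first branch. The quotient is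
   written with the power -1 to get its measurability from that of [powR]. *)
pose A u : R := atan (complex.Im (rho2 R n z u) * complex.Re (rho2 R n z u) `^ (-1)).
have mA : measurable_fun setT A.
  apply: (measurableT_comp (f := @atan R)).
    by apply: continuous_measurable_fun => x; exact: continuous_atan.
  apply: measurable_funM; first exact: measurable_Im_rho2.
  by apply: measurable_powR_comp; exact: measurable_Re_rho2.
have AE u : TB R n u -> Arg R (rho2 R n z u) = A u.
  move=> hu; have p := Re_rho2_gt0 _ _ hz hu.
  by rewrite /Arg p /A powR_inv1// ltW.
have mm : measurable_fun setT (fun u => cmod R (rho2 R n z u) `^ (- c)).
  apply: measurable_powR_comp; apply: measurable_cmod.
    exact: measurable_Re_rho2.
  exact: measurable_Im_rho2.
split.
  apply: (eq_measurable_fun (fun u => cmod R (rho2 R n z u) `^ (- c) * cos (c * A u))).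
    move=> u; rewrite inE => hu.
    by rewrite /Tker cpowV ?cmod_rho2_gt0//= AE.
  apply: measurable_funTS; apply: measurable_funM => //.
  apply: (measurableT_comp (f := @cos R)).
    by apply: continuous_measurable_fun => x; exact: continuous_cos.
  exact: measurable_funM.
apply: (eq_measurable_fun (fun u => - (cmod R (rho2 R n z u) `^ (- c) * sin (c * A u)))).
  move=> u; rewrite inE => hu.
  by rewrite /Tker cpowV ?cmod_rho2_gt0//= AE.
apply: measurable_funTS; apply: measurable_funN; apply: measurable_funM => //.
apply: (measurableT_comp (f := @sin R)).
  by apply: continuous_measurable_fun => x; exact: continuous_sin.
exact: measurable_funM.
Qed.

(* The properties shared by the kernels of [S] and [T] on which everything below rests; the
   last one replaces the positivity of the kernel of [S]. *)
Definition good_kernel (K : Cn R n -> Cn R n -> R -> R[i]) : Prop :=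
  [/\ forall z u c, cmod R (K z u c) = cmod R (rho2 R n z u) `^ (- c),
      forall z c, TB R n z ->
        measurable_fun (TB R n) (fun u => complex.Re (K z u c)) /\
        measurable_fun (TB R n) (fun u => complex.Im (K z u c)) &
      forall c1 c2, exists2 d : R, 0 < d & forall z u w e,
        TB R n z -> TB R n u -> TB R n w -> TB R n e ->
        `|complex.Im (rho2 R n z u)| <= d * complex.Re (rho2 R n z u) ->
        `|complex.Im (rho2 R n w e)| <= d * complex.Re (rho2 R n w e) ->
        2^-1 * (cmod R (rho2 R n z u) `^ (- c1) * cmod R (rho2 R n w e) `^ (- c2))
          <= complex.Re (K z u c1 * K w e c2)].

Lemma Sker_good : good_kernel (Sker R n).
Proof.
split=> [z u c|z c hz|c1 c2].
- by rewrite /Sker cmod_real powRN ger0_norm// invr_ge0 powR_ge0.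
- split; last exact: measurable_cst.
  by apply: measurable_funTS; exact: measurable_Sker.
(* The kernel of [S] is positive and equal to its modulus, so any aperture would do. *)
exists 1 => // z u w e _ _ _ _ _ _.
rewrite cRe_mul /= mulr0 subr0 !powRN ler_piMl ?mulr_ge0 ?invr_ge0 ?powR_ge0//; lra.
Qed.

Lemma Tker_good : good_kernel (Tker R n).
Proof.
split=> [z u c|z c hz|c1 c2].
- by rewrite /Tker cmodV cmod_cpow powRN.
- exact: measurable_Tker.
have [d d0 H] := nearly_real_kernel c1 c2.
by exists d => // z u w e hz hu hw he h1 h2; apply: H => //; exact: Re_rho2_gt0.
Qed.

End Rho.

(** * Sufficiency *)

Section TonelliRect.
Context d1 d2 (T1 : measurableType d1) (T2 : measurableType d2) (R : realType).
Variables (m1 : {sigma_finite_measure set T1 -> \bar R})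
  (m2 : {sigma_finite_measure set T2 -> \bar R}).
Variables (D1 : set T1) (D2 : set T2).
Hypotheses (mD1 : measurable D1) (mD2 : measurable D2).
Variable g : T1 * T2 -> \bar R.
Hypothesis mg : measurable_fun (D1 `*` D2) g.
Hypothesis g0 : forall x, (D1 `*` D2) x -> (0 <= g x)%E.

Let h := g \_ (D1 `*` D2).

Let mh : measurable_fun setT h.
Proof. by apply/(measurable_restrictT _ _).1 => //; exact: measurableX. Qed.

Let h0 x : (0 <= h x)%E. Proof. exact: erestrict_ge0. Qed.

Let hE y : (\int[m1]_x h (x, y))%E =
  ((fun y => \int[m1]_(x in D1) g (x, y))%E \_ D2) y.
Proof.
rewrite patchE; case: ifPn => yD2.
  rewrite [RHS]integral_mkcond; apply: eq_integral => x _.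
  rewrite /h !patchE in_setX/= yD2 andbT; by case: ifP.
rewrite integral0_eq// => x _.
by rewrite /h patchE in_setX/= (negbTE yD2) andbF.
Qed.

(** Tonelli's theorem on the whole product, applied to the extension of [g] by 0. *)
Lemma tonelli_rect : (\int[pmeas m1 m2]_(x in D1 `*` D2) g x =
  \int[m2]_(y in D2) \int[m1]_(x in D1) g (x, y))%E.
Proof.
rewrite integral_mkcond [RHS]integral_mkcond -/h.
transitivity (\int[m2]_y \int[m1]_x h (x, y))%E.
  exact: (@fubini_tonelli2 _ _ _ _ R m1 m2 h mh h0).
by apply: eq_integral => y _; exact: hE.
Qed.

Lemma measurable_tonelli_rect :
  measurable_fun D2 (fun y => \int[m1]_(x in D1) g (x, y))%E.
Proof.
apply/(measurable_restrictT _ _).2 => //.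
rewrite -(funext hE).
exact: (@measurable_fun_fubini_tonelli_G _ _ _ _ R m1 h mh h0).
Qed.

End TonelliRect.

(** * Hoelder's inequality with an extended-valued factor *)

Section Hoelder.
Context d (T : measurableType d) (R : realType).
Variable mu : {measure set T -> \bar R}.
Variables (D : set T) (mD : measurable D).

(* [N] may take the value [+oo], as inner integrals do, hence the proof through Young's
   inequality instead of [hoelder], which is about real-valued functions. *)
Lemma hoelder_extended (k : T -> R) (N : T -> \bar R) (p q S Y : R) :
  measurable_fun D k -> measurable_fun D N ->
  (forall x, D x -> 0 <= k x) -> (forall x, D x -> 0 <= N x)%E ->
  0 < p -> 0 < q -> p^-1 + q^-1 = 1 -> 0 < S -> 0 < Y ->
  (\int[mu]_(x in D) (k x `^ q)%:E <= (S `^ q)%:E)%E ->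
  (\int[mu]_(x in D) (N x `^ p) <= (Y `^ p)%:E)%E ->
  (\int[mu]_(x in D) ((k x)%:E * N x) <= (S * Y)%:E)%E.
Proof.
move=> mk mN k0 N0 p0 q0 pq S0 Y0 hk hN.
have Sq := powR_gt0 q S0; have Yp := powR_gt0 p Y0.
(* These come from Young's inequality for [k / S] and [N / Y], multiplied by [S Y]. After
   integration the two terms are at most [S Y / q] and [S Y / p], which add up to [S Y]. *)
pose c1 := S * Y / (q * S `^ q); pose c2 := S * Y / (p * Y `^ p).
have c10 : 0 < c1 by rewrite !mulr_gt0// invr_gt0 mulr_gt0.
have c20 : 0 < c2 by rewrite !mulr_gt0// invr_gt0 mulr_gt0.
have mkq : measurable_fun D (fun x => (k x `^ q)%:E).
  by apply/measurable_EFinP; exact: measurable_powR_comp.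
have mNp : measurable_fun D (fun x => N x `^ p)%E.
  by apply: (measurableT_comp (f := (@poweR R ^~ p))) => //; exact: measurable_poweR.
apply: (@le_trans _ _ (\int[mu]_(x in D)
    (c1%:E * (k x `^ q)%:E + c2%:E * (N x `^ p)))%E).
  apply: ge0_le_integral => //.
  - by move=> x Dx; rewrite mule_ge0 ?lee_fin ?k0 ?N0.
  - by apply: emeasurable_funM => //; exact/measurable_EFinP.
  - by apply: emeasurable_funD; apply: measurable_funeM.
  (* Where [N] is infinite so is the majorant, because [c2] is positive. *)
  move=> x Dx; have := N0 x Dx; case: (N x) => [r||//]; last first.
    move=> _; rewrite poweRyr ?gt_eqF// (@gt0_muley _ c2%:E) ?lte_fin//.
    by rewrite -EFinM addey// leey.
  rewrite lee_fin poweR_EFin -!EFinM -EFinD lee_fin => r0.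
  have := @conjugate_powR R (r / Y) (k x / S) p q.
  move=> /(_ _ _ p0 q0 pq).
  have rY : 0 <= r / Y by rewrite divr_ge0// ltW.
  have kS : 0 <= k x / S by rewrite divr_ge0 ?k0// ltW.
  move=> /(_ rY kS).
  rewrite !powRM ?invr_ge0 ?k0 ?(ltW S0) ?(ltW Y0)//.
  have V (u v : R) : 0 < u -> (u^-1) `^ v = (u `^ v)^-1.
    by move=> u0; rewrite -powR_inv1 ?ltW// -powRrM mulN1r powRN.
  rewrite !V// => H.
  have SY0 : 0 < S * Y by rewrite mulr_gt0.
  have := ler_wpM2l (ltW SY0) H.
  have -> : S * Y * (r / Y * (k x / S)) = k x * r by field; rewrite !gt_eqF.
  move=> /le_trans; apply; rewrite le_eqVlt; apply/orP; left; apply/eqP.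
  by rewrite /c1 /c2; field; rewrite !gt_eqF.
rewrite ge0_integralD//; last 4 first.
- by move=> x Dx; rewrite mule_ge0 ?lee_fin ?powR_ge0// ltW.
- exact: measurable_funeM.
- by move=> x Dx; rewrite mule_ge0 ?lee_fin ?poweR_ge0// ltW.
- exact: measurable_funeM.
rewrite !ge0_integralZl//; try by rewrite lee_fin ltW.
- apply: (le_trans (leeD (lee_wpmul2l _ hk) (lee_wpmul2l _ hN))).
  + by rewrite lee_fin ltW.
  + by rewrite lee_fin ltW.
  rewrite -!EFinM -EFinD lee_fin le_eqVlt; apply/orP; left; apply/eqP.
  have -> : S * Y = S * Y * (p^-1 + q^-1) by rewrite pq mulr1.
  by rewrite /c1 /c2; field; rewrite !gt_eqF.
- by move=> x _; rewrite poweR_ge0.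
- by move=> x _; rewrite lee_fin powR_ge0.
Qed.

End Hoelder.

(** * The Forelli-Rudin type integral of the kernel over [T_B] *)

Section KernelIntegral.
Context {R : realType}.
Variable m : nat.
Local Notation n := m.+1.
Local Notation co := (Defs.coord R (2 * n)).
Implicit Types (z u w e : Cn R n).

Lemma sum_pairs (f : nat -> R) : \sum_(i < 2 * m) f i =
  \sum_(j < m) (f (2 * j)%N + f (2 * j + 1)%N).
Proof.
elim: m => [|l IH]; first by rewrite muln0 !big_ord0.
rewrite [RHS]big_ord_recr /= -IH.
have -> : (2 * l.+1 = (2 * l).+2)%N by rewrite mulnS.
by rewrite !big_ord_recr /= addn1 addrA.
Qed.

(* [psiS] and [phiS] read [|y'|^2] and the shift of the last real part off the list of the
   first [2 * m] real coordinates. *)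
Definition psiS (q : seq R) : R := \sum_(j < m) (nth 0 q (2 * j + 1)) ^+ 2.

Definition phiS w (q : seq R) : R := xc R n w m -
  \sum_(j < m) (xc R n w j - nth 0 q (2 * j)) * (yc R n w j + nth 0 q (2 * j + 1)).

Lemma nth_even (c : nat -> R) (j : 'I_m) : nth 0 (mkseq c (2 * m)) (2 * j) = c (2 * j)%N.
Proof. by rewrite nth_mkseq// ltn_pmul2l. Qed.

Lemma nth_odd (c : nat -> R) (j : 'I_m) :
  nth 0 (mkseq c (2 * m)) (2 * j + 1) = c (2 * j + 1)%N.
Proof.
rewrite nth_mkseq//.
have := ltn_ord j; rewrite -(leq_pmul2l (isT : 0 < 2)%N) mulnS; apply: leq_trans.
by rewrite addn1.
Qed.

Lemma rho_psi z : rho R n z = co z (2 * m).+1 - psiS (mkseq (co z) (2 * m)).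
Proof.
rewrite /rho /= {1}/yc addn1; congr (_ - _).
by apply: eq_bigr => j _; rewrite nth_odd.
Qed.

Lemma twist_phi w z : twist m w z = co z (2 * m) - phiS w (mkseq (co z) (2 * m)).
Proof.
rewrite /twist /phiS; congr (_ - (_ - _)).
by apply: eq_bigr => j _; rewrite nth_even nth_odd.
Qed.

Lemma sqdist_coord w z : sqdist m w z = \sum_(i < 2 * m) (co z i - co w i) ^+ 2.
Proof.
rewrite (sum_pairs (fun i => (co z i - co w i) ^+ 2)).
by apply: eq_bigr => j _; rewrite -(sqrrN (xc _ _ _ _ - _)) -(sqrrN (yc _ _ _ _ - _)) !opprB.
Qed.

(* [2 * m.+1] is [(2 * m).+2] only propositionally. *)
Lemma integral_Rn_le_cast (s t : R) k K : K = k.+2 -> -1 < s -> s + 2 + k%:R / 2 < t ->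
  exists2 C : R, 0 < C &
  forall (A : R) (w : nat -> R) (phi psi : seq R -> R) (F : rn_T R (Rn R K) -> \bar R),
  0 < A -> measurable_fun setT F -> (forall v, 0 <= F v)%E ->
  (forall v, let r := Defs.coord R _ v k.+1 - psi (mkseq (Defs.coord R _ v) k) in
     (F v <= (if (0 < r)%R then
       r `^ s * (A + \sum_(i < k) (Defs.coord R _ v i - w i) ^+ 2 + r
         + `|Defs.coord R _ v k - phi (mkseq (Defs.coord R _ v) k)|) `^ (- t) else 0)%:E)%E) ->
  (\int[rn_mu R (Rn R K)]_v F v <= (C * A `^ (s + 2 + k%:R / 2 - t))%:E)%E.
Proof. by move=> ->; exact: integral_Rn_le. Qed.

Lemma measurable_cmod_rho2 w t : measurable_fun setT (fun u => cmod R (rho2 R n w u) `^ t).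
Proof.
apply: measurable_powR_comp; apply: measurable_cmod.
  exact: measurable_Re_rho2.
exact: measurable_Im_rho2.
Qed.

(** This is [integral_Rn_le] with [A = rho(w)] and the [2 m] real coordinates of [z']: each of them
    contributes one half to the exponent and the last two contribute 2, hence [s + n + 1 - t]. *)
Lemma integral_kernel_le (s t : R) : -1 < s -> s + n%:R + 1 < t ->
  exists2 C : R, 0 < C & forall w, TB R n w ->
  (\int[dV R n]_(e in TB R n) (rho R n e `^ s * cmod R (rho2 R n w e) `^ (- t))%:E
   <= (C * rho R n w `^ (s + n%:R + 1 - t))%:E)%E.
Proof.
move=> s1 st.
have kE : s + 2 + (2 * m)%:R / 2 = s + n%:R + 1.
  by rewrite natrM -natr1; field.
have [C C0 HC] := @integral_Rn_le_cast s t (2 * m) (2 * n) (mulnS 2 m) s1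
  (eq_ind_r (fun x => x < t) st kE).
have t0 : 0 <= t.
  by rewrite ltW// (le_lt_trans _ st)// -addrA -natr1; have := ler0n R m; lra.
exists (8 `^ t * C) => [|w hw]; first by rewrite mulr_gt0 ?powR_gt0.
(* The factor absorbs the constant [1 / 8] of [cmod_rho2_ge]. *)
pose G e : R := 8 `^ (- t) * (rho R n e `^ s * cmod R (rho2 R n w e) `^ (- t)).
have mG : measurable_fun setT G.
  apply: measurable_funM => //; apply: measurable_funM.
    by apply: measurable_powR_comp; exact: measurable_rho.
  exact: measurable_cmod_rho2.
have G0 e : 0 <= G e by rewrite !mulr_ge0 ?powR_ge0.
have -> : (\int[dV R n]_(e in TB R n)
    (rho R n e `^ s * cmod R (rho2 R n w e) `^ (- t))%:E =
   (8 `^ t)%:E * \int[dV R n]_(e in TB R n) (G e)%:E)%E.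
  rewrite -ge0_integralZl//; last 3 first.
  - exact: measurable_TB.
  - by apply: measurable_funTS; apply/measurable_EFinP.
  - by move=> e _; rewrite lee_fin.
  apply: eq_integral => e _; rewrite -EFinM /G; congr EFin.
  have h : (8 : R) `^ t * (8 : R) `^ (- t) = 1.
    by rewrite powRN divff// gt_eqF// powR_gt0.
  by rewrite [RHS]mulrA h mul1r.
rewrite -mulrA EFinM; apply: lee_wpmul2l; first by rewrite lee_fin powR_ge0.
rewrite -kE integral_mkcond.
apply: (HC _ (co w) (phiS w) psiS).
- exact: hw.
- apply/(measurable_restrictT _ _).1; first exact: measurable_TB.
  by apply: measurable_funTS; apply/measurable_EFinP.
- by apply: erestrict_ge0 => e _; rewrite lee_fin.
move=> e; rewrite -rho_psi -sqdist_coord -twist_phi patchE /=.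
have [he|he] := boolP (e \in TB R n); last first.
  by rewrite lee_fin; case: ifP => // _; rewrite mulr_ge0 ?powR_ge0.
rewrite inE in he; rewrite he lee_fin /G mulrCA ler_wpM2l ?powR_ge0//.
have X0 : 0 < rho R n w + sqdist m w e + rho R n e + `|twist m w e|.
  have := sqdist_ge0 m w e; have := normr_ge0 (twist m w e).
  move: hw he; rewrite /TB/=; lra.
rewrite -powRM ?cmod_ge0//; apply: ler_powRN => //.
have := cmod_rho2_ge m _ _ hw he; lra.
Qed.

End KernelIntegral.

(** * Boundedness of an operator with a good kernel *)

Section Operator.
Context {R : realType}.
Variable m : nat.
Local Notation n := m.+1.
Local Notation D := (TB R n).
Local Notation rh := (rho R n).
Local Notation mod2 := (fun z u => cmod R (rho2 R n z u)).
Variable K : Cn R n -> Cn R n -> R -> R[i].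
Hypothesis gK : good_kernel m K.
Variables (a b c al : R * R).
Implicit Types (f : Cn R n * Cn R n -> R[i]) (z u w e : Cn R n).

Lemma measurable_TBX : measurable (D `*` D).
Proof. by apply: measurableX; exact: measurable_TB. Qed.

Lemma measurable_comp_fst d (T : measurableType d) (g : Cn R n -> T) :
  measurable_fun D g -> measurable_fun (D `*` D) (fun x => g x.1).
Proof.
move=> mg; apply: (measurable_comp _ _ mg); first exact: measurable_TB.
  by move=> _ [x [? ?] <-].
exact: measurable_funTS.
Qed.

Lemma measurable_comp_snd d (T : measurableType d) (g : Cn R n -> T) :
  measurable_fun D g -> measurable_fun (D `*` D) (fun x => g x.2).
Proof.
move=> mg; apply: (measurable_comp _ _ mg); first exact: measurable_TB.
  by move=> _ [x [? ?] <-].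
exact: measurable_funTS.
Qed.

Lemma measurable_complexM d (T : measurableType d) (E : set T) (g h : T -> R[i]) :
  measurable_fun E (fun x => complex.Re (g x)) ->
  measurable_fun E (fun x => complex.Im (g x)) ->
  measurable_fun E (fun x => complex.Re (h x)) ->
  measurable_fun E (fun x => complex.Im (h x)) ->
  measurable_fun E (fun x => complex.Re (g x * h x)) /\
  measurable_fun E (fun x => complex.Im (g x * h x)).
Proof.
move=> ? ? ? ?; split.
  by under eq_fun do rewrite cRe_mul; apply: measurable_funB; apply: measurable_funM.
by under eq_fun do rewrite cIm_mul; apply: measurable_funD; apply: measurable_funM.
Qed.

Lemma measurable_rho_powR d : measurable_fun D (fun u => rh u `^ d).
Proof.
by apply: measurable_funTS; apply: measurable_powR_comp; exact: measurable_rho.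
Qed.

Lemma measurable_op_integrand f zw : (D `*` D) zw ->
  measurable_fun (D `*` D) (fun x => complex.Re (f x)) ->
  measurable_fun (D `*` D) (fun x => complex.Im (f x)) ->
  measurable_fun (D `*` D) (fun x => complex.Re (op_integrand R n K b c f zw x)) /\
  measurable_fun (D `*` D) (fun x => complex.Im (op_integrand R n K b c f zw x)).
Proof.
move=> [hz hw] mr mi; case: gK => _ mK _; rewrite /op_integrand.
have [m1r m1i] := mK zw.1 c.1 hz; have [m2r m2i] := mK zw.2 c.2 hw.
have [A1 A2] := measurable_complexM _ _ _ (fun x => K zw.1 x.1 c.1) (fun x => K zw.2 x.2 c.2)
  (measurable_comp_fst _ _ _ m1r) (measurable_comp_fst _ _ _ m1i)
  (measurable_comp_snd _ _ _ m2r) (measurable_comp_snd _ _ _ m2i).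
have [||B1 B2] := measurable_complexM _ _ _ _
  (fun x : Cn R n * Cn R n => (rh x.1 `^ b.1 * rh x.2 `^ b.2)%:C%C) A1 A2.
- apply: measurable_funM.
    by apply: (measurable_comp_fst _ _ (fun u => rh u `^ b.1)); exact: measurable_rho_powR.
  by apply: (measurable_comp_snd _ _ (fun u => rh u `^ b.2)); exact: measurable_rho_powR.
- exact: measurable_cst.
exact: measurable_complexM.
Qed.

Lemma cmod_op_integrand f zw ue : cmod R (op_integrand R n K b c f zw ue) =
  mod2 zw.1 ue.1 `^ (- c.1) * mod2 zw.2 ue.2 `^ (- c.2) *
  (rh ue.1 `^ b.1 * rh ue.2 `^ b.2) * cmod R (f ue).
Proof.
case: gK => mK _ _; rewrite /op_integrand 3!cmodM !mK cmod_real.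
by rewrite ger0_norm// mulr_ge0 ?powR_ge0.
Qed.

Variable p : R.
Hypothesis p1 : 1 < p.
Hypotheses (a1 : 0 <= a.1) (a2 : 0 < a.2) (b1 : al.1 <= b.1)
  (b2 : al.2 + 1 < p * (b.2 + 1)) (cE1 : c.1 = a.1 + b.1 - al.1)
  (cE2 : c.2 = n%:R + 1 + a.2 + b.2 - (n%:R + 1 + al.2) / p).

Let q := p / (p - 1).
Let p0 : 0 < p. Proof. by move: p1; lra. Qed.
Let pm0 : 0 < p - 1. Proof. by move: p1; lra. Qed.
Let q0 : 0 < q. Proof. by rewrite divr_gt0. Qed.
Let pq : p^-1 + q^-1 = 1.
Proof. by rewrite /q; field; rewrite !gt_eqF. Qed.

Let inner_norm f e : \bar R := (\int[dV R n]_(u in D) (cmod R (f (u, e)) * rh u `^ al.1)%:E)%E.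

Lemma mixed_normE f : mixed_norm R n (1%R, p) al f =
  ((\int[dV R n]_(e in D) ((inner_norm f e `^ p) * (rh e `^ al.2)%:E)) `^ p^-1)%E.
Proof.
rewrite /mixed_norm -[(1, p).2]/p -[(1, p).1]/(1 : R) divr1.
congr (_ `^ _)%E.
apply: eq_integral => e _; congr (poweR _ _ * _)%E.
by apply: eq_integral => u _; rewrite powRr1 ?cmod_ge0.
Qed.

Lemma first_kernel_le z u : D z -> D u ->
  mod2 z u `^ (- c.1) * rh u `^ b.1 <= 2 `^ c.1 * rh z `^ (- a.1) * rh u `^ al.1.
Proof.
move=> hz hu.
have z0 : 0 < rh z := hz; have u0 : 0 < rh u := hu.
have M0 := cmod_rho2_gt0 m _ _ hz hu.
have M2 : 0 < 2 * cmod R (rho2 R n z u) by rewrite mulr_gt0.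
(* The power [a.1] of [2 |rho(z,u)|] dominates that of [rho(z)], and the power [b.1 - al.1]
   dominates that of [rho(u)]. *)
have h : rh z `^ a.1 * rh u `^ (b.1 - al.1) <= 2 `^ c.1 * mod2 z u `^ c.1.
  rewrite -powRM ?(ltW M0)// (_ : c.1 = a.1 + (b.1 - al.1)); last by rewrite cE1 addrA.
  rewrite [leRHS]powRD_pos//; apply: ler_pM; rewrite ?powR_ge0//.
    by apply: ge0_ler_powR; rewrite ?nnegrE ?(ltW M2) ?(ltW z0)// rho_le_cmod.
  apply: ge0_ler_powR; rewrite ?nnegrE ?(ltW M2) ?(ltW u0) ?subr_ge0//.
  by rewrite rho_le_cmodr.
rewrite !powRN mulrC ler_pdivrMr ?powR_gt0//.
have -> : rh u `^ b.1 = rh u `^ (b.1 - al.1) * rh u `^ al.1.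
  by rewrite -powRD_pos// subrK.
have -> : 2 `^ c.1 / rh z `^ a.1 * rh u `^ al.1 * mod2 z u `^ c.1 =
  (2 `^ c.1 * mod2 z u `^ c.1) / rh z `^ a.1 * rh u `^ al.1 by ring.
rewrite ler_wpM2r ?powR_ge0// ler_pdivlMr ?powR_gt0// mulrC; exact: h.
Qed.

Lemma second_kernel_le : exists2 C : R, 0 < C & forall w, D w ->
  (\int[dV R n]_(e in D)
     ((mod2 w e `^ (- c.2) * rh e `^ (b.2 - al.2 / p)) `^ q)%:E
   <= ((C * rh w `^ (- a.2)) `^ q)%:E)%E.
Proof.
pose s := q * (b.2 - al.2 / p); pose t := c.2 * q.
have qE : q * (1 - p^-1) = 1 by rewrite /q; field; rewrite !gt_eqF.
(* Convergence at the boundary of [T_B]: after multiplication by [p / q] this is [b2]. *)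
have s1 : -1 < s.
  rewrite /s -[-1](_ : q * (- (1 - p^-1)) = -1); last by rewrite mulrN qE.
  rewrite ltr_pM2l// -subr_gt0 -(pmulr_rgt0 _ p0).
  have -> : p * (b.2 - al.2 / p - - (1 - p^-1)) = p * (b.2 + 1) - (al.2 + 1).
    by field; rewrite gt_eqF.
  by rewrite subr_gt0.
(* The prescribed value of [c.2] makes the exponent [- a.2 q]; convergence at infinity asks for it
   to be negative, which is [a2]. *)
have tE : s + n%:R + 1 - t = - a.2 * q.
  by rewrite /s /t cE2 /q; field; rewrite !gt_eqF.
have [|C C0 HC] := integral_kernel_le m s t s1 _.
  by rewrite -subr_lt0 tE mulNr oppr_lt0 mulr_gt0.
exists (C `^ q^-1) => [|w hw]; first exact: powR_gt0.
rewrite (_ : (C `^ q^-1 * _) `^ q = C * rh w `^ (s + n%:R + 1 - t)); last first.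
  rewrite powRM ?powR_ge0// -!powRrM mulVf ?gt_eqF// powRr1 ?(ltW C0)//.
  by rewrite tE.
apply: le_trans (HC w hw).
rewrite (_ : (\int[dV R n]_(e in D) _)%E = (\int[dV R n]_(e in D)
  (rh e `^ s * mod2 w e `^ (- t))%:E)%E)//.
apply: eq_integral => e _; congr EFin.
by rewrite powRM ?powR_ge0// -!powRrM mulrC /s /t mulNr [_ * q]mulrC.
Qed.

Let A z := 2 `^ c.1 * rh z `^ (- a.1).

Lemma inner_norm_ge0 f e : (0 <= inner_norm f e)%E.
Proof. by apply: integral_ge0 => u _; rewrite lee_fin mulr_ge0 ?cmod_ge0 ?powR_ge0. Qed.

Lemma measurable_integrand_norm f :
  measurable_fun (D `*` D) (fun x => complex.Re (f x)) ->
  measurable_fun (D `*` D) (fun x => complex.Im (f x)) ->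
  measurable_fun (D `*` D)
    (fun x : Cn R n * Cn R n => (cmod R (f x) * rh x.1 `^ al.1)%:E).
Proof.
move=> mr mi; apply/measurable_EFinP; apply: measurable_funM.
  exact: measurable_cmod.
by apply: (measurable_comp_fst _ _ (fun u => rh u `^ al.1)); exact: measurable_rho_powR.
Qed.

Lemma measurable_inner_norm f :
  measurable_fun (D `*` D) (fun x => complex.Re (f x)) ->
  measurable_fun (D `*` D) (fun x => complex.Im (f x)) ->
  measurable_fun D (inner_norm f).
Proof.
move=> mr mi; apply: (@measurable_tonelli_rect _ _ _ _ R (dV R n) D D _ _
  (fun x : Cn R n * Cn R n => (cmod R (f x) * rh x.1 `^ al.1)%:E)).
- exact: measurable_TB.
- exact: measurable_TB.
- exact: measurable_integrand_norm.
- by move=> x _; rewrite lee_fin mulr_ge0 ?cmod_ge0 ?powR_ge0.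
Qed.

Lemma inner_integral_le f z w e : D z -> D e ->
  measurable_fun (D `*` D) (fun x => complex.Re (f x)) ->
  measurable_fun (D `*` D) (fun x => complex.Im (f x)) ->
  (\int[dV R n]_(u in D) (cmod R (op_integrand R n K b c f (z, w) (u, e)))%:E <=
   (A z * (mod2 w e `^ (- c.2) * rh e `^ b.2))%:E * inner_norm f e)%E.
Proof.
move=> hz he mr mi.
have msec (g : Cn R n * Cn R n -> R) : measurable_fun (D `*` D) g ->
    measurable_fun D (fun u => g (u, e)).
  move=> mg; apply: (@measurable_comp _ _ _ _ _ _ (D `*` D)) mg _.
  - exact: measurable_TBX.
  - by move=> _ [u hu <-].
  - by apply: measurable_funTS; exact: pair2_measurable.
have mcf : measurable_fun D (fun u => cmod R (f (u, e))).
  by apply: (msec (fun x => cmod R (f x))); exact: measurable_cmod.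
have mg : measurable_fun D (fun u => (cmod R (f (u, e)) * rh u `^ al.1)%:E).
  by apply/measurable_EFinP; apply: measurable_funM => //; exact: measurable_rho_powR.
have Az : 0 <= A z by rewrite mulr_ge0 ?powR_ge0.
rewrite /inner_norm -ge0_integralZl//; last 3 first.
- exact: measurable_TB.
- by move=> u _; rewrite lee_fin mulr_ge0 ?cmod_ge0 ?powR_ge0.
- by rewrite lee_fin !mulr_ge0 ?powR_ge0.
apply: ge0_le_integral.
- exact: measurable_TB.
- by move=> u _; rewrite lee_fin cmod_ge0.
- apply/measurable_EFinP; under eq_fun do rewrite cmod_op_integrand/=.
  apply: measurable_funM => //; apply: measurable_funM.
    by apply: measurable_funM => //; apply: measurable_funTS; exact: measurable_cmod_rho2.
  by apply: measurable_funM => //; exact: measurable_rho_powR.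
- exact: measurable_funeM.
move=> u hu; rewrite -EFinM lee_fin cmod_op_integrand/=.
have := first_kernel_le _ _ hz hu; rewrite -/(A z).
set k1 := _ `^ (- c.1); set k2 := _ `^ (- c.2); set r1 := rh u `^ b.1.
set r2 := rh e `^ b.2; set r3 := rh u `^ al.1; set F := cmod R (f _) => h.
have -> : k1 * k2 * (r1 * r2) * F = (k1 * r1) * (k2 * r2 * F) by ring.
have -> : A z * (k2 * r2) * (F * r3) = (A z * r3) * (k2 * r2 * F) by ring.
by rewrite ler_wpM2r// !mulr_ge0 ?powR_ge0 ?cmod_ge0.
Qed.

Lemma mixed_norm_fin f : (mixed_norm R n (1%R, p) al f < +oo)%E ->
  exists2 N : R, 0 <= N & mixed_norm R n (1%R, p) al f = N%:E /\
  (\int[dV R n]_(e in D) ((inner_norm f e `^ p) * (rh e `^ al.2)%:E) = (N `^ p)%:E)%E.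
Proof.
rewrite mixed_normE; set X := (\int[_]_(_ in _) _)%E => fin.
have X0 : (0 <= X)%E.
  by apply: integral_ge0 => e _; rewrite mule_ge0 ?poweR_ge0// lee_fin powR_ge0.
exists (fine (X `^ p^-1)%E); first by rewrite fine_ge0// poweR_ge0.
have E : (X `^ p^-1)%E = (fine (X `^ p^-1)%E)%:E.
  by rewrite fineK// ge0_fin_numE// poweR_ge0.
split=> //; rewrite -poweR_EFin -E -poweRrM mulVf ?gt_eqF// poweRe1//.
Qed.

(** The integral in [u] is estimated first and leaves the weighted L^1 norm of [f(., e)]; Hoelder's
    inequality is then applied in [e] alone. *)
Lemma double_integral_le f z w (S : R) : D z -> D w -> 0 < S ->
  in_Lmixed R n (1%R, p) al f ->
  (\int[dV R n]_(e in D)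
     ((mod2 w e `^ (- c.2) * rh e `^ (b.2 - al.2 / p)) `^ q)%:E <= (S `^ q)%:E)%E ->
  (\int[dV2 R n]_(x in D `*` D) (cmod R (op_integrand R n K b c f (z, w) x))%:E
    <= (A z * S)%:E * mixed_norm R n (1%R, p) al f)%E.
Proof.
move=> hz hw S0 [mr [mi fin]] HS.
have [N N0 [NE XE]] := mixed_norm_fin f fin.
have Az : 0 <= A z by rewrite mulr_ge0 ?powR_ge0.
have [mor moi] := measurable_op_integrand f (z, w) (conj hz hw) mr mi.
rewrite (tonelli_rect _ _ _ _ R (dV R n) (dV R n) D D); last 4 first.
- exact: measurable_TB.
- exact: measurable_TB.
- by apply/measurable_EFinP; exact: measurable_cmod.
- by move=> x _; rewrite lee_fin cmod_ge0.
(* The power [b.2] of [rho(e)] is split so that the [p]-th power of [NN] carries exactly the weight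
   [al.2] of the mixed norm. *)
pose kk e := mod2 w e `^ (- c.2) * rh e `^ (b.2 - al.2 / p).
pose NN e := (inner_norm f e * (rh e `^ (al.2 / p))%:E)%E.
have mkk : measurable_fun D kk.
  apply: measurable_funM; last exact: measurable_rho_powR.
  by apply: measurable_funTS; exact: measurable_cmod_rho2.
have mNN : measurable_fun D NN.
  apply: emeasurable_funM; first exact: measurable_inner_norm.
  by apply/measurable_EFinP; exact: measurable_rho_powR.
have NN0 e : (0 <= NN e)%E.
  by rewrite mule_ge0 ?inner_norm_ge0// lee_fin powR_ge0.
have kk0 e : 0 <= kk e by rewrite mulr_ge0 ?powR_ge0.
apply: (@le_trans _ _ ((A z)%:E * \int[dV R n]_(e in D) ((kk e)%:E * NN e))%E).
  rewrite -ge0_integralZl//; last 3 first.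
  - exact: measurable_TB.
  - by apply: emeasurable_funM => //; exact/measurable_EFinP.
  - by move=> e _; rewrite mule_ge0// lee_fin.
  apply: ge0_le_integral.
  - exact: measurable_TB.
  - by move=> e _; apply: integral_ge0 => u _; rewrite lee_fin cmod_ge0.
  - apply: (@measurable_tonelli_rect _ _ _ _ R (dV R n) D D _ _
      (fun x => (cmod R (op_integrand R n K b c f (z, w) x))%:E)).
    + exact: measurable_TB.
    + exact: measurable_TB.
    + by apply/measurable_EFinP; exact: measurable_cmod.
    + by move=> x _; rewrite lee_fin cmod_ge0.
  - by apply: measurable_funeM; apply: emeasurable_funM => //; exact/measurable_EFinP.
  move=> e he; apply: (le_trans (inner_integral_le _ _ _ _ hz he mr mi)).
  have re : 0 < rh e := he.
  rewrite /NN /kk [(inner_norm f e * _)%E]muleC !muleA -!EFinM.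
  rewrite -!mulrA -powRD_pos// subrK; exact: lexx.
rewrite NE (EFinM (A z) S) -muleA; apply: lee_wpmul2l; first by rewrite lee_fin.
rewrite -EFinM; apply/lee_addgt0Pr => eps eps0.
(* [N] itself may vanish. *)
pose Y := N + eps / S.
have Y0 : 0 < Y by rewrite ltr_wpDl// divr_gt0.
have -> : ((S * N)%:E + eps%:E = (S * Y)%:E)%E.
  by rewrite -EFinD /Y mulrDr mulrCA mulfV ?mulr1// gt_eqF.
apply: (hoelder_extended _ _ _ _ D _ kk NN p q) => //.
- exact: measurable_TB.
- rewrite (_ : (\int[dV R n]_(x in D) (NN x `^ p))%E = (N `^ p)%:E).
    rewrite lee_fin ge0_ler_powR ?nnegrE ?(ltW p0) ?(ltW Y0)//.
    by rewrite /Y lerDl ltW// divr_gt0.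
  rewrite -XE; apply: eq_integral => e _.
  rewrite /NN poweRM ?inner_norm_ge0 ?lee_fin ?powR_ge0// poweR_EFin -powRrM.
  by rewrite divfK// gt_eqF.
Qed.

Lemma good_kernel_bounded : bounded_to_Linf R n K a b c (1, p) al.
Proof.
have [C C0 HC] := second_kernel_le.
(* The factor 2 comes from bounding the real and the imaginary part separately by the integral of
   the modulus. *)
exists (2 * (2 `^ c.1 * C)) => f Lf; apply: aeW => -[z w] /= [/= hz hw].
have z0 : 0 < rh z := hz; have w0 : 0 < rh w := hw.
have [mr [mi fin]] := Lf.
have [N N0 [NE _]] := mixed_norm_fin f fin.
have := double_integral_le f z w (C * rh w `^ (- a.2)) hz hw _ Lf (HC w hw).
rewrite mulr_gt0 ?powR_gt0// NE => /(_ isT).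
set I := (\int[_]_(_ in _) _)%E => hI.
have Ioo : (I < +oo)%E by apply: (le_lt_trans hI); rewrite -EFinM ltry.
have [mor moi] := measurable_op_integrand f (z, w) (conj hz hw) mr mi.
have mc : measurable_fun (D `*` D)
    (fun x => (cmod R (op_integrand R n K b c f (z, w) x))%:E).
  by apply/measurable_EFinP; exact: measurable_cmod.
have bound (h : Cn R n * Cn R n -> R) : measurable_fun (D `*` D) h ->
    (forall x, `|h x| <= cmod R (op_integrand R n K b c f (z, w) x)) ->
    (dV2 R n).-integrable (D `*` D) (EFin \o h) /\
    (`|Rintegral (dV2 R n) (D `*` D) h|%:E <= I)%E.
  move=> mh hle.
  have mEh : measurable_fun (D `*` D) (EFin \o h) by exact/measurable_EFinP.
  have le1 : (\int[dV2 R n]_(x in D `*` D) `|(EFin \o h) x| <= I)%E.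
    apply: ge0_le_integral => //.
    - exact: measurable_TBX.
    - exact: measurableT_comp.
    - by move=> x _; rewrite /= lee_fin.
  have ih : (dV2 R n).-integrable (D `*` D) (EFin \o h).
    by apply/integrableP; split => //; exact: le_lt_trans Ioo.
  split=> //; apply: le_trans le1.
  rewrite /Rintegral -abse_EFin fineK; last first.
    by apply: integrable_fin_num => //; exact: measurable_TBX.
  by apply: le_abse_integral => //; exact: measurable_TBX.
have [i1 l1] := bound _ mor (fun x => ler_Re_cmod _).
have [i2 l2] := bound _ moi (fun x => ler_Im_cmod _).
split; first by split.
rewrite /op_value /= cmodM cmod_real ger0_norm ?mulr_ge0 ?powR_ge0//.
set r := rh z `^ a.1 * rh w `^ a.2.
have r0 : 0 <= r by rewrite mulr_ge0 ?powR_ge0.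
apply: (@le_trans _ _ (r%:E * (I + I))%E).
  rewrite EFinM; apply: lee_wpmul2l; first by rewrite lee_fin.
  apply: (@le_trans _ _ (`|Rintegral (dV2 R n) (D `*` D)
      (fun x => complex.Re (op_integrand R n K b c f (z, w) x))|%:E +
    `|Rintegral (dV2 R n) (D `*` D)
      (fun x => complex.Im (op_integrand R n K b c f (z, w) x))|%:E)%E).
    by rewrite -EFinD lee_fin; exact: cmod_le_ReIm.
  exact: leeD.
apply: (le_trans (lee_wpmul2l _ (leeD hI hI))); first by rewrite lee_fin.
have -> : forall x u v : R,
  (x%:E * (u%:E * v%:E + u%:E * v%:E) = (x * (u * v + u * v))%:E)%E by [].
rewrite -EFinM lee_fin le_eqVlt; apply/orP; left; apply/eqP.
rewrite /r /A !powRN; field.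
by rewrite !gt_eqF ?powR_gt0.
Qed.

End Operator.

(** * Necessity *)

Section MeasureFacts.
Context d (T : measurableType d) (R : realType).
Variable mu : {measure set T -> \bar R}.

(** Turns the almost everywhere estimate into an estimate at one point of a prescribed box. *)
Lemma ae_exists (P : T -> Prop) (B : set T) : {ae mu, forall x, P x} ->
  measurable B -> (0 < mu B)%E -> exists2 x, B x & P x.
Proof.
move=> [A [mA A0 hA]] mB B0; apply: contrapT => h.
have BA : B `<=` A by move=> x Bx; apply: hA => /= Px; apply: h; exists x.
have : (mu B <= mu A)%E by apply: le_measure; rewrite ?inE.
by rewrite A0 leNgt B0.
Qed.

Lemma integral_sum_indic (D : set T) N (x : 'I_N -> R) (A : 'I_N -> set T) (v : 'I_N -> R) :
  measurable D -> (forall i, measurable (A i)) -> (forall i, A i `<=` D) ->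
  (forall i, 0 <= x i) -> (forall i, mu (A i) = (v i)%:E) ->
  (\int[mu]_(y in D) (\sum_(i < N) x i * \1_(A i) y)%:E = (\sum_(i < N) x i * v i)%:E)%E.
Proof.
move=> mD mA AD x0 muA.
under eq_integral do rewrite -sumEFin.
rewrite ge0_integral_sum//; last 2 first.
- move=> i; apply/measurable_EFinP; apply: measurable_funM => //.
- by move=> i y _; rewrite lee_fin mulr_ge0.
rewrite -sumEFin; apply: eq_bigr => i _.
under eq_integral do rewrite EFinM.
rewrite ge0_integralZl//; last 2 first.
- by apply/measurable_EFinP.
- by rewrite lee_fin.
by rewrite integral_indic// setIidl// muA EFinM.
Qed.

Lemma measurable_sum_indic (D : set T) N (x : 'I_N -> R) (A : 'I_N -> set T) :
  (forall i, measurable (A i)) ->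
  measurable_fun D (fun y => \sum_(i < N) x i * \1_(A i) y).
Proof.
by move=> mA; apply: measurable_sum => i; apply: measurable_funM.
Qed.

End MeasureFacts.

(** * Comparison and growth of real powers *)

Section PowerFacts.
Context {R : realType}.
Implicit Types x y e B C : R.

(** Treats exponents of either sign alike. The factor 4 covers both [rho] on a box of height [r],
    which lies in [(r, 2 r]], and the moduli in [box_kernel]. *)
Lemma powR_between x B e : 0 < B -> B / 4 <= x -> x <= 4 * B ->
  4 `^ (- `|e|) * B `^ e <= x `^ e <= 4 `^ `|e| * B `^ e.
Proof.
move=> B0 l u.
have x0 : 0 < x by apply: lt_le_trans l; rewrite divr_gt0.
have four0 : (0 : R) < 4 by lra.
have main (y z f : R) : 0 < y -> y <= 4 * z -> 0 < z -> 0 <= f ->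
    y `^ f <= 4 `^ f * z `^ f.
  move=> y0 yz z0 f0; rewrite -powRM ?(ltW z0) ?(ltW four0)//.
  by apply: ge0_ler_powR; rewrite ?nnegrE ?(ltW y0)// mulr_ge0 ?(ltW z0) ?(ltW four0).
have xB : B <= 4 * x by lra.
have [e0|e0] := leP 0 e.
  rewrite ger0_norm// main// andbT.
  by rewrite powRN mulrC ler_pdivrMr ?powR_gt0// mulrC main.
rewrite ltr0_norm// opprK.
have e' : 0 <= - e by lra.
have h1 := main x B (- e) x0 u B0 e'.
have h2 := main B x (- e) B0 xB x0 e'.
rewrite !powRN in h1 h2 *.
have f0 : 0 < 4 `^ e :> R by exact: powR_gt0.
have g0 : 0 < B `^ e by exact: powR_gt0.
have k0 : 0 < x `^ e by exact: powR_gt0.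
apply/andP; split.
  move: h1; rewrite -invfM lef_pV2 ?posrE ?mulr_gt0//.
move: h2; rewrite -invfM lef_pV2 ?posrE ?mulr_gt0// => h2.
by rewrite mulrC ler_pdivlMr// mulrC.
Qed.

Lemma natr_powR_unbounded e C : 0 < e -> ~ (forall N : nat, N.+1%:R `^ e <= C).
Proof.
move=> e0 H.
have C0 : 0 <= C by apply: le_trans (H 0%N); rewrite powR_ge0.
have := H (Num.truncn ((C + 1) `^ e^-1)).
have := truncnS_gt ((C + 1) `^ e^-1); set N := _.+1%:R => h.
have : ((C + 1) `^ e^-1) `^ e < N `^ e.
  by apply: gt0_ltr_powR => //; rewrite ?nnegrE ?powR_ge0 ?ler0n.
by rewrite -powRrM mulVf ?gt_eqF// powRr1; lra.
Qed.

Lemma powR_bounded_ge0 e C : (forall x, 0 < x -> x <= 1 -> x `^ e <= C) -> 0 <= e.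
Proof.
move=> H; rewrite leNgt; apply/negP => e0.
apply: (natr_powR_unbounded (- e) C); first by rewrite oppr_gt0.
move=> N; have h : 0 < N.+1%:R :> R by rewrite ltr0n.
have := H (N.+1%:R)^-1; rewrite invr_gt0 h invf_le1// ler1n => /(_ isT isT).
by rewrite -[_^-1]powR_inv1 ?(ltW h)// -powRrM mulN1r.
Qed.

Lemma powR_bounded_eq0 e C : (forall x, 0 < x -> x `^ e <= C) -> e = 0.
Proof.
move=> H; apply: le_anti; apply/andP; split; last first.
  by apply: (powR_bounded_ge0 e C) => x x0 _; exact: H.
rewrite -oppr_ge0; apply: (powR_bounded_ge0 (- e) C) => x x0 _.
have -> : x `^ (- e) = x^-1 `^ e.
  by rewrite -[_^-1]powR_inv1 ?(ltW x0)// -powRrM mulN1r.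
by apply: H; rewrite invr_gt0.
Qed.

(** Dividing by [N^(1/p)] would bound the positive power [1 - 1/p] of [N]. *)
Lemma linear_not_powR x y C p : 0 < x -> 0 <= y -> 1 < p ->
  ~ (forall N : nat, x * N.+1%:R <= C * (y * N.+1%:R) `^ p^-1).
Proof.
move=> x0 y0 p1 H.
have pe : 0 < 1 - p^-1 by rewrite subr_gt0 invf_lt1//; lra.
apply: (natr_powR_unbounded (1 - p^-1) (C * y `^ p^-1 / x)) => // N.
have := H N; have h : 0 < N.+1%:R :> R by rewrite ltr0n.
have hE : N.+1%:R `^ (1 - p^-1) = N.+1%:R * N.+1%:R `^ (- p^-1).
  by rewrite powRD_pos// powRr1 ?(ltW h).
have hV : N.+1%:R `^ p^-1 * N.+1%:R `^ (- p^-1) = 1 by rewrite -powRD_pos// subrr powRr0.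
rewrite powRM ?(ltW h)// mulrA => /(ler_wpM2r (powR_ge0 N.+1%:R (- p^-1))).
move=> hh; rewrite -[leLHS]mulrA -hE -[leRHS]mulrA hV mulr1 in hh.
by rewrite ler_pdivlMr// mulrC.
Qed.

End PowerFacts.

(** * Parabolic boxes and the kernel on them *)

Section Boxes.
Context {R : realType}.
Variable m : nat.
Local Notation n := m.+1.
Local Notation co := (Defs.coord R (2 * n)).
Local Notation D := (TB R n).
Local Notation rh := (rho R n).
Implicit Types (z u w e : Cn R n) (L r h k : R).

(** The first [2 m] real coordinates scale like the square root of the last real part, as they do in
    [|y'|^2 < y_n]. The horizontal size [L] and the height [r] are kept independent. *)
Definition box L r : set (Cn R n) :=
  [set z | in_box (2 * m) (Num.sqrt L) L r (2 * r) (psiS m) (co z)].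

Definition vol L r : R := (2 * Num.sqrt L) ^+ (2 * m) * (2 * L) * r.

Lemma boxP L r z : box L r z <-> [/\ forall i, (i < 2 * m)%N -> `|co z i| <= Num.sqrt L,
  `|co z (2 * m)%N| <= L & r < rh z <= 2 * r].
Proof. by rewrite rho_psi. Qed.

Lemma volE L r : 0 <= L -> vol L r = 2 * 4 ^+ m * L ^+ n * r.
Proof.
move=> L0.
have h : (2 * Num.sqrt L) ^+ 2 = 4 * L by rewrite exprMn sqr_sqrtr//; ring.
by rewrite /vol exprM h exprMn [L ^+ n]exprS; ring.
Qed.

Lemma vol_gt0 L r : 0 < L -> 0 < r -> 0 < vol L r.
Proof.
by move=> L0 r0; rewrite volE ?ltW// !mulr_gt0// exprn_gt0// mulr_gt0.
Qed.

Lemma box_sub L r : 0 < r -> box L r `<=` D.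
Proof. by move=> r0 z /boxP[_ _ /andP[h _]]; rewrite /TB/=; exact: lt_trans h. Qed.

Lemma measurable_box L r : measurable (box L r).
Proof.
have -> : box L r =
    (\bigcap_i [set z | (i < 2 * m)%N -> `|co z i| <= Num.sqrt L]) `&`
    ([set z | `|co z (2 * m)%N| <= L] `&` ([set z | r < rh z] `&` [set z | rh z <= 2 * r])).
  apply/seteqP; split=> [z /boxP[h1 h2 /andP[h3 h4]]|z [h1 [h2 [h3 h4]]]].
    by split=> // i _; exact: h1.
  by apply/boxP; split=> [i ik|//|]; [exact: (h1 i I)|apply/andP].
have mco i : measurable_fun setT (fun z => `|co z i|).
  by apply: measurableT_comp; [exact: normr_measurable|exact: measurable_coord].
apply: measurableI.
  apply: bigcapT_measurable => i; case: (boolP (i < 2 * m)%N) => ik; last first.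
    by rewrite (_ : [set z | _] = setT)// -subTset.
  rewrite (_ : [set z | _] = [set z | `|co z i| <= Num.sqrt L]); last first.
    by apply/seteqP; split=> z /=; [exact|].
  by rewrite -[X in measurable X]setTI; apply: measurable_fun_ler.
apply: measurableI.
  by rewrite -[X in measurable X]setTI; apply: measurable_fun_ler.
apply: measurableI; rewrite -[X in measurable X]setTI.
  by apply: measurable_fun_ltr => //; exact: measurable_rho.
by apply: measurable_fun_ler => //; exact: measurable_rho.
Qed.

Lemma measure_Rn_box_cast K (k : nat) (l l' r1 r2 : R) (psi : seq R -> R)
    (B : set (rn_T R (Rn R K))) : K = k.+2 ->
  0 <= l -> 0 <= l' -> r1 < r2 -> measurable B ->
  (forall v, B v <-> in_box k l l' r1 r2 psi (Defs.coord R _ v)) ->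
  rn_mu R (Rn R K) B = ((2 * l) ^+ k * (2 * l') * (r2 - r1))%:E.
Proof. by move=> KE; subst K; exact: measure_Rn_box. Qed.

Lemma measure_box L r : 0 < L -> 0 < r -> dV R n (box L r) = (vol L r)%:E.
Proof.
move=> L0 r0.
have -> : vol L r = (2 * Num.sqrt L) ^+ (2 * m) * (2 * L) * (2 * r - r).
  by rewrite /vol; ring.
apply: (@measure_Rn_box_cast _ _ _ _ _ _ (psiS m)).
- by rewrite mulnS.
- exact: sqrtr_ge0.
- exact: ltW.
- by lra.
- exact: measurable_box.
- by [].
Qed.

(** Put [s = h + k] and [t = e2 s]. The boxes give [sqdist <= 8 m t] and [|twist| <= (2 + 4 m) t],
    so [|Im| <= (1 + 2 m) t = dl s / 8] by the choice of [e2], while [Re >= s / 2]. *)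
Lemma box_kernel (dl e2 L1 L2 h k : R) z u : 0 < dl -> dl <= 1 ->
  e2 = dl / (8 * (2 * m%:R + 1)) -> 0 < h -> 0 < k -> 0 < L1 -> 0 < L2 ->
  L1 <= e2 * (h + k) -> L2 <= e2 * (h + k) -> box L1 h z -> box L2 k u ->
  [/\ `|complex.Im (rho2 R n z u)| <= dl * complex.Re (rho2 R n z u),
      (h + k) / 4 <= cmod R (rho2 R n z u) & cmod R (rho2 R n z u) <= 4 * (h + k)].
Proof.
move=> dl0 dl1 e2E h0 k0 L10 L20 hL1 hL2 bz bu.
have hz := box_sub _ _ h0 _ bz; have hu := box_sub _ _ k0 _ bu.
have /boxP[z1 z2 /andP[z3 z4]] := bz; have /boxP[u1 u2 /andP[u3 u4]] := bu.
set s := h + k in hL1 hL2 *.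
have s0 : 0 < s by rewrite addr_gt0.
have M0 : 0 < 2 * m%:R + 1 :> R by rewrite ltr_wpDl// mulr_ge0.
have e2s : e2 * s * (8 * (2 * m%:R + 1)) = dl * s.
  by rewrite e2E; field; rewrite !gt_eqF//.
set t := e2 * s in hL1 hL2 e2s.
have t0 : 0 <= t by exact: le_trans (ltW L10) hL1.
(* [(|x| + |y|)^2 <= 2 (x^2 + y^2) <= 2 (L1 + L2) <= 4 t]. *)
have bnd (x y : R) : `|x| <= Num.sqrt L1 -> `|y| <= Num.sqrt L2 -> (`|x| + `|y|) ^+ 2 <= 4 * t.
  move=> hx hy.
  have x2 : `|x| ^+ 2 <= L1.
    by rewrite -(sqr_sqrtr (ltW L10)) ler_sqr ?nnegrE ?sqrtr_ge0.
  have y2 : `|y| ^+ 2 <= L2.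
    by rewrite -(sqr_sqrtr (ltW L20)) ler_sqr ?nnegrE ?sqrtr_ge0.
  have := sqr_ge0 (`|x| - `|y|); rewrite sqrrB sqrrD.
  move: x2 y2; set X := `|x| ^+ 2; set Y := `|y| ^+ 2; set Z := `|x| * `|y|; lra.
have jE (j : 'I_m) : (2 * j < 2 * m)%N by rewrite ltn_pmul2l.
have jO (j : 'I_m) : (2 * j + 1 < 2 * m)%N.
  have := ltn_ord j; rewrite -(leq_pmul2l (isT : 0 < 2)%N) mulnS; apply: leq_trans.
  by rewrite addn1.
have sq1 x y : (x - y) ^+ 2 <= (`|x| + `|y|) ^+ 2 :> R.
  by rewrite -real_normK ?num_real// ler_sqr ?nnegrE ?addr_ge0// ler_normB.
have sqd : sqdist m z u <= m%:R * (8 * t).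
  have -> : m%:R * (8 * t) = \sum_(j < m) (8 * t).
    by rewrite sumr_const card_ord mulr_natl.
  apply: ler_sum => j _.
  have := bnd _ _ (z1 _ (jE j)) (u1 _ (jE j)); have := bnd _ _ (z1 _ (jO j)) (u1 _ (jO j)).
  have := sq1 (xc R n z j) (xc R n u j); have := sq1 (yc R n z j) (yc R n u j).
  rewrite /xc /yc; lra.
have tw : `|twist m z u| <= 2 * t + m%:R * (4 * t).
  have sL : (Num.sqrt L1 + Num.sqrt L2) ^+ 2 <= 4 * t.
    have := bnd (Num.sqrt L1) (Num.sqrt L2).
    by rewrite !ger0_norm ?sqrtr_ge0//; apply.
  have sm : `|\sum_(j < m) (xc R n z j - xc R n u j) * (yc R n z j + yc R n u j)|
      <= m%:R * (4 * t).
    have -> : m%:R * (4 * t) = \sum_(j < m) (4 * t).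
      by rewrite sumr_const card_ord mulr_natl.
    apply: (le_trans (ler_norm_sum _ _ _)); apply: ler_sum => j _.
    rewrite normrM; apply: le_trans sL; rewrite expr2.
    apply: ler_pM => //.
      by apply: (le_trans (ler_normB _ _)); rewrite lerD ?z1 ?u1.
    by apply: (le_trans (ler_normD _ _)); rewrite lerD ?z1 ?u1.
  rewrite /twist; apply: (le_trans (ler_normB _ _)).
  have := ler_normB (xc R n z m)
    (\sum_(j < m) (xc R n z j - xc R n u j) * (yc R n z j + yc R n u j)).
  move: sm z2 u2; rewrite /xc; lra.
have mt0 : 0 <= m%:R * t by rewrite mulr_ge0.
have e2s' : 16 * (m%:R * t) + 8 * t = dl * s by rewrite -e2s; ring.
have dls : dl * s <= s by rewrite ler_piMl// ltW.
have sqd0 := sqdist_ge0 m z u.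
have Re_ge : s / 2 <= complex.Re (rho2 R n z u) by rewrite Re_rho2 /s; lra.
have Re_le : complex.Re (rho2 R n z u) <= s + 2 * (m%:R * t).
  by move: sqd; rewrite Re_rho2 /s mulrCA; lra.
have Im_le : `|complex.Im (rho2 R n z u)| <= t + 2 * (m%:R * t).
  by rewrite Im_rho2 normrM [`|2^-1|]gtr0_norm ?invr_gt0//; move: tw; lra.
have Re0 := Re_rho2_gt0 m _ _ hz hu.
split.
- have := ler_wpM2l (ltW dl0) Re_ge; rewrite mulrA; lra.
- by have := ler_Re_cmod (rho2 R n z u); rewrite gtr0_norm//; lra.
- by have := cmod_le_ReIm (rho2 R n z u); rewrite [`|complex.Re _|]gtr0_norm//; lra.
Qed.

End Boxes.

Lemma Re_mul_real (R : realType) (x : R[i]) (r : R) :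
  complex.Re (x * r%:C%C) = complex.Re x * r.
Proof. by rewrite cRe_mul /= mulr0 subr0. Qed.

(** * Test functions: a box times a weighted sum of dyadic layers *)

Section TestFunction.
Context {R : realType}.
Variable m : nat.
Local Notation n := m.+1.
Local Notation D := (TB R n).
Local Notation rh := (rho R n).
Local Notation mod2 := (fun z u => cmod R (rho2 R n z u)).
Implicit Types (z u w e : Cn R n).
Variables (Lu k lam : R) (N : nat) (mm L : nat -> R).
Hypotheses (Lu0 : 0 < Lu) (k0 : 0 < k) (lam0 : 0 < lam)
  (mm0 : forall i, 0 <= mm i) (L0 : forall i, 0 < L i).

Definition dyad (i : nat) : R := lam * 2^-1 ^+ i.

Lemma dyad_gt0 i : 0 < dyad i.
Proof. by rewrite mulr_gt0// exprn_gt0// invr_gt0. Qed.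

Lemma dyad_half i j : (i < j)%N -> 2 * dyad j <= dyad i.
Proof.
move=> ij; rewrite /dyad mulrCA ler_wpM2l ?(ltW lam0)//.
rewrite -(subnKC ij) addSn exprS mulrA divff// mul1r exprD.
by rewrite ler_piMr ?exprn_ge0 ?exprn_ile1 ?invr_ge0// invf_le1// ler1n.
Qed.

(** The sizes [L i] stay free because two regimes are used later: a fixed size in [b2_condition],
    and a size proportional to the height in [a2_condition]. *)
Definition layer (i : nat) : set (Cn R n) := box m (L i) (dyad i).

Lemma layer_disjoint i j e : layer i e -> layer j e -> i = j.
Proof.
have W (i1 j1 : nat) : layer i1 e -> layer j1 e -> ~ (i1 < j1)%N.
  move=> /boxP[_ _ /andP[h1 _]] /boxP[_ _ /andP[_ h2]] /dyad_half; lra.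
move=> hi hj; case: (ltngtP i j) => // /W h; exfalso; exact: h.
Qed.

Lemma measurable_layer i : measurable (layer i).
Proof. exact: measurable_box. Qed.

Lemma layer_sub i : layer i `<=` D.
Proof. by apply: box_sub; exact: dyad_gt0. Qed.

Lemma measure_layer i : dV R n (layer i) = (vol m (L i) (dyad i))%:E.
Proof. by apply: measure_box => //; exact: dyad_gt0. Qed.

Definition profile e : R := \sum_(i < N) mm i * \1_(layer i) e.

Definition test (x : Cn R n * Cn R n) : R[i] :=
  ((\1_(box m Lu k) x.1 * profile x.2)%:C)%C.

Lemma profile_ge0 e : 0 <= profile e.
Proof. by apply: sumr_ge0 => i _; rewrite mulr_ge0. Qed.

Lemma measurable_profile (E : set (Cn R n)) : measurable_fun E profile.
Proof. by apply: measurable_sum_indic => i; exact: measurable_layer. Qed.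

Lemma measurable_test : measurable_fun (D `*` D) (fun x => complex.Re (test x)) /\
  measurable_fun (D `*` D) (fun x => complex.Im (test x)).
Proof.
split; last exact: measurable_cst.
apply: measurable_funM.
  apply: (measurable_comp_fst m _ _ (\1_(box m Lu k) : _ -> R)).
  by apply: measurable_indic; exact: measurable_box.
by apply: (measurable_comp_snd m _ _ profile); exact: measurable_profile.
Qed.

Lemma cmod_test x : cmod R (test x) = \1_(box m Lu k) x.1 * profile x.2.
Proof. by rewrite cmod_real ger0_norm// mulr_ge0// profile_ge0. Qed.

Variables (al : R * R) (p : R).
Hypothesis p1 : 1 < p.

Let Q := 4 `^ `|al.1| * k `^ al.1 * vol m Lu k.

Lemma rho_box L' r u d : 0 < r -> box m L' r u ->
  4 `^ (- `|d|) * r `^ d <= rh u `^ d <= 4 `^ `|d| * r `^ d.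
Proof. by move=> r0 /boxP[_ _ /andP[h1 h2]]; apply: powR_between => //; lra. Qed.

Lemma test_inner_norm e :
  (\int[dV R n]_(u in D) (cmod R (test (u, e)) * rh u `^ al.1)%:E
   <= (profile e * Q)%:E)%E.
Proof.
(* A one-term sum, so that [integral_sum_indic] computes the integral of the majorant. *)
have -> : profile e * Q =
    \sum_(i < 1) (profile e * (4 `^ `|al.1| * k `^ al.1)) * vol m Lu k.
  by rewrite big_ord1 /Q; ring.
rewrite -(@integral_sum_indic _ _ R (dV R n) D 1 _ (fun _ => box m Lu k))//; last 5 first.
- exact: measurable_TB.
- by move=> _; exact: measurable_box.
- by move=> _; exact: box_sub.
- by move=> _; rewrite !mulr_ge0 ?powR_ge0 ?profile_ge0.
- by move=> _; exact: measure_box.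
apply: ge0_le_integral.
- exact: measurable_TB.
- by move=> u _; rewrite lee_fin mulr_ge0 ?cmod_ge0 ?powR_ge0.
- apply/measurable_EFinP.
  rewrite (_ : (fun u => _) = (fun u => \1_(box m Lu k) u * profile e * rh u `^ al.1)).
    apply: measurable_funM; last exact: measurable_rho_powR.
    by apply: measurable_funM => //; apply: measurable_indic; exact: measurable_box.
  by apply/funext => u; rewrite cmod_test.
- by apply/measurable_EFinP; apply: measurable_sum_indic => i; exact: measurable_box.
move=> u hu; rewrite lee_fin big_ord1 cmod_test /= indicE.
have [ub|ub] := boolP (u \in _); last by rewrite !mulr0 !mul0r.
rewrite mulr1 mul1r ler_wpM2l ?profile_ge0//.
by rewrite inE in ub; have /andP[] := rho_box _ _ _ al.1 k0 ub.
Qed.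

(** The layers are disjoint, so at most one term of [profile] survives at [e] and the [p]-th power
    passes through the sum. *)
Lemma profile_powR e : D e -> (profile e * Q) `^ p * rh e `^ al.2 <=
  \sum_(i < N) (Q `^ p * 4 `^ `|al.2| * (mm i `^ p * dyad i `^ al.2)) * \1_(layer i) e.
Proof.
move=> he; have p0 : 0 < p := lt_trans ltr01 p1.
have Q0 : 0 <= Q.
  by rewrite /Q mulr_ge0 ?(mulr_ge0 (powR_ge0 _ _) (powR_ge0 _ _))// ltW// vol_gt0.
have [[i hi]|h] := pselect (exists i : 'I_N, layer i e); last first.
  have -> : profile e = 0.
    apply: big1 => i _; rewrite indicE memNset ?mulr0// => hi; apply: h.
    by exists i.
  rewrite mul0r powR0 ?gt_eqF// mul0r; apply: sumr_ge0 => i _.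
  by rewrite !mulr_ge0 ?powR_ge0.
have z (j : 'I_N) : j != i -> \1_(layer j) e = 0 :> R.
  move=> ji; rewrite indicE memNset// => hj; move/negP: ji; apply; apply/eqP.
  by apply: val_inj; exact: (layer_disjoint _ _ _ hj hi).
have o : \1_(layer i) e = 1 :> R by rewrite indicE mem_set.
rewrite /profile (bigD1 i)//= big1 ?addr0; last by move=> j ji; rewrite z// mulr0.
rewrite (bigD1 i)//= [X in _ <= _ + X]big1 ?addr0; last by move=> j ji; rewrite z// mulr0.
rewrite o !mulr1 powRM//.
have f0 : 0 <= mm i `^ p * Q `^ p by rewrite mulr_ge0 ?powR_ge0.
have /andP[_ hh] := rho_box _ _ _ al.2 (dyad_gt0 i) hi.
apply: (le_trans (ler_wpM2l f0 hh)).
by rewrite le_eqVlt; apply/orP; left; apply/eqP; ring.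
Qed.

Let M := \sum_(i < N) mm i `^ p * dyad i `^ al.2 * vol m (L i) (dyad i).

Lemma test_mixed_norm : (mixed_norm R n (1%R, p) al test <=
  (Q * (4 `^ `|al.2| * M) `^ p^-1)%:E)%E.
Proof.
have p0 : 0 < p := lt_trans ltr01 p1.
have Q0 : 0 <= Q.
  by rewrite /Q mulr_ge0 ?(mulr_ge0 (powR_ge0 _ _) (powR_ge0 _ _))// ltW// vol_gt0.
have M0 : 0 <= M.
  apply: sumr_ge0 => i _.
  rewrite mulr_ge0 ?(mulr_ge0 (powR_ge0 _ _) (powR_ge0 _ _))// ltW//.
  by rewrite vol_gt0// dyad_gt0.
have [mr mi] := measurable_test.
rewrite mixed_normE.
have -> : Q * (4 `^ `|al.2| * M) `^ p^-1 = (Q `^ p * (4 `^ `|al.2| * M)) `^ p^-1.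
  rewrite [RHS]powRM ?powR_ge0 ?mulr_ge0 ?powR_ge0//.
  by rewrite -powRrM mulfV ?gt_eqF// powRr1.
rewrite -poweR_EFin; apply: gt0_ler_poweR.
- by rewrite invr_ge0 ltW.
- rewrite in_itv/= leey andbT; apply: integral_ge0 => e _.
  by rewrite mule_ge0 ?poweR_ge0// lee_fin powR_ge0.
- by rewrite in_itv/= leey andbT lee_fin !mulr_ge0 ?powR_ge0.
have -> : Q `^ p * (4 `^ `|al.2| * M) = \sum_(i < N)
    (Q `^ p * 4 `^ `|al.2| * (mm i `^ p * dyad i `^ al.2)) * vol m (L i) (dyad i).
  by rewrite mulrA /M mulr_sumr; apply: eq_bigr => i _; rewrite mulrA.
rewrite -(@integral_sum_indic _ _ R (dV R n) D N _ (fun i => layer i))//; last 5 first.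
- exact: measurable_TB.
- by move=> i; exact: measurable_layer.
- by move=> i; exact: layer_sub.
- by move=> i; rewrite !mulr_ge0 ?powR_ge0.
- by move=> i; exact: measure_layer.
apply: ge0_le_integral.
- exact: measurable_TB.
- by move=> e _; rewrite mule_ge0 ?poweR_ge0// lee_fin powR_ge0.
- apply: emeasurable_funM; last first.
    by apply/measurable_EFinP; exact: measurable_rho_powR.
  apply: (measurableT_comp (f := (@poweR R ^~ p))); first exact: measurable_poweR.
  exact: measurable_inner_norm.
- apply/measurable_EFinP; apply: measurable_sum_indic => i; exact: measurable_layer.
move=> e he; apply: (@le_trans _ _ ((profile e * Q) `^ p * rh e `^ al.2)%:E); last first.
  by rewrite lee_fin; exact: profile_powR.
rewrite EFinM; apply: lee_wpmul2r; first by rewrite lee_fin powR_ge0.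
rewrite -poweR_EFin; apply: gt0_ler_poweR; first exact: ltW.
- rewrite in_itv/= leey andbT; apply: integral_ge0 => u _.
  by rewrite lee_fin mulr_ge0 ?cmod_ge0 ?powR_ge0.
- by rewrite in_itv/= leey andbT lee_fin mulr_ge0 ?profile_ge0.
- exact: test_inner_norm.
Qed.

Variable K : Cn R n -> Cn R n -> R -> R[i].
Variables (b c : R * R) (j h dl e2 Lz Lw : R).
Hypotheses (j0 : 0 < j) (h0 : 0 < h) (dl0 : 0 < dl) (dl1 : dl <= 1)
  (e2E : e2 = dl / (8 * (2 * m%:R + 1))).
Hypothesis Kre : forall z u w e,
  TB R n z -> TB R n u -> TB R n w -> TB R n e ->
  `|complex.Im (rho2 R n z u)| <= dl * complex.Re (rho2 R n z u) ->
  `|complex.Im (rho2 R n w e)| <= dl * complex.Re (rho2 R n w e) ->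
  2^-1 * (cmod R (rho2 R n z u) `^ (- c.1) * cmod R (rho2 R n w e) `^ (- c.2))
    <= complex.Re (K z u c.1 * K w e c.2).
Hypotheses (Lz0 : 0 < Lz) (Lw0 : 0 < Lw) (hLz : Lz <= e2 * (h + k))
  (hLu : Lu <= e2 * (h + k)) (hLw : forall i, (i < N)%N -> Lw <= e2 * (j + dyad i))
  (hL : forall i, (i < N)%N -> L i <= e2 * (j + dyad i)).

(** Lower bound for the real part of the integrand on the [i]-th product of boxes: one half from
    [Kre], the powers of 4 from [powR_between]. *)
Let kap i := 2^-1 * (4 `^ (- `|c.1|) * (h + k) `^ (- c.1) *
    (4 `^ (- `|c.2|) * (j + dyad i) `^ (- c.2))) *
  (4 `^ (- `|b.1|) * k `^ b.1 * (4 `^ (- `|b.2|) * dyad i `^ b.2)) * mm i.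

Lemma test_integrand_ge z w u e : box m Lz h z -> box m Lw j w -> D u -> D e ->
  \sum_(i < N) kap i * \1_(box m Lu k `*` layer i) (u, e) <=
  complex.Re (op_integrand R n K b c test (z, w) (u, e)).
Proof.
move=> hz hw hu he.
have Dz := box_sub m _ _ h0 _ hz; have Dw := box_sub m _ _ j0 _ hw.
have -> : complex.Re (op_integrand R n K b c test (z, w) (u, e)) =
   \sum_(i < N) (complex.Re (K z u c.1 * K w e c.2) * (rh u `^ b.1 * rh e `^ b.2) * mm i)
      * \1_(box m Lu k `*` layer i) (u, e).
  rewrite /op_integrand /test.
  rewrite !Re_mul_real -[(z, w).1]/z -[(z, w).2]/w -[(u, e).1]/u -[(u, e).2]/e.
  rewrite /profile mulr_sumr mulr_sumr; apply: eq_bigr => i _.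
  rewrite (_ : \1_(box m Lu k `*` layer i) (u, e) =
    \1_(box m Lu k) u * \1_(layer i) e :> R); last first.
    by rewrite !indicE in_setX /= -natrM mulnb.
  ring.
apply: ler_sum => i _; rewrite indicE in_setX /=.
have [ub|ub] := boolP (u \in _); last by rewrite !mulr0.
have [eb|eb] := boolP (e \in _); last by rewrite !mulr0.
rewrite !mulr1; rewrite inE in ub; rewrite inE in eb.
have [I1 l1 u1] := box_kernel m _ _ _ _ _ _ z u dl0 dl1 e2E h0 k0 Lz0 Lu0 hLz hLu hz ub.
have [I2 l2 u2] := box_kernel m _ _ _ _ _ _ w e dl0 dl1 e2E j0 (dyad_gt0 i) Lw0 (L0 i)
  (hLw i (ltn_ord i)) (hL i (ltn_ord i)) hw eb.
have hk0 : 0 < h + k by rewrite addr_gt0.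
have jd0 : 0 < j + dyad i by rewrite addr_gt0// dyad_gt0.
have /andP[p1' _] := powR_between _ _ (- c.1) hk0 l1 u1.
have /andP[p2' _] := powR_between _ _ (- c.2) jd0 l2 u2.
rewrite !normrN in p1' p2'.
have /andP[p3 _] := rho_box _ _ _ b.1 k0 ub.
have /andP[p4 _] := rho_box _ _ _ b.2 (dyad_gt0 i) eb.
rewrite /kap ler_wpM2r// ler_pM ?mulr_ge0 ?powR_ge0 ?invr_ge0//.
- apply: le_trans (Kre z u w e Dz hu Dw he I1 I2).
  by rewrite ler_wpM2l ?invr_ge0// ler_pM ?mulr_ge0 ?powR_ge0.
- by rewrite ler_pM ?mulr_ge0 ?powR_ge0.
Qed.

(** The modulus of the integral is at least its real part, and the integrand has a real part above a
    nonnegative step function, so oscillation of the kernel cannot cause cancellation. *)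
Lemma test_integral_ge z w : box m Lz h z -> box m Lw j w ->
  cintegrable R n (op_integrand R n K b c test (z, w)) ->
  \sum_(i < N) kap i * (vol m Lu k * vol m (L i) (dyad i)) <=
  cmod R (cint R n (op_integrand R n K b c test (z, w))).
Proof.
move=> hz hw [ir _].
apply: le_trans (le_trans (ler_norm _) (ler_Re_cmod _)).
rewrite -[complex.Re (cint _ _ _)]/(Rintegral _ _ _) /Rintegral -lee_fin fineK; last first.
  by apply: integrable_fin_num => //; exact: measurable_TBX.
have kap0 i : 0 <= kap i by rewrite !mulr_ge0 ?powR_ge0 ?invr_ge0.
have mX i : measurable (box m Lu k `*` layer i).
  by apply: measurableX; exact: measurable_box.
rewrite -(@integral_sum_indic _ _ R (dV2 R n) (D `*` D) N _
  (fun i => box m Lu k `*` layer i))//; last 3 first.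
- exact: measurable_TBX.
- by move=> i x [x1 x2]; split; [exact: box_sub x1|exact: layer_sub x2].
- move=> i; rewrite EFinM -measure_box// -measure_layer.
  by apply: product_measure1E; [exact: measurable_box|exact: measurable_layer].
apply: ge0_le_integral.
- exact: measurable_TBX.
- by move=> x _; rewrite lee_fin; apply: sumr_ge0 => i _; rewrite mulr_ge0.
- by apply/measurable_EFinP; exact: measurable_sum_indic.
- by case/integrableP: ir.
- by move=> [u e] [hu he]; rewrite lee_fin; exact: test_integrand_ge.
Qed.

End TestFunction.

(** * The scalar inequality obtained from the test functions *)

Section TestInequality.
Context {R : realType}.
Variable m : nat.
Local Notation n := m.+1.
Local Notation D := (TB R n).
Local Notation rh := (rho R n).
Variable K : Cn R n -> Cn R n -> R -> R[i].
Hypothesis gK : good_kernel m K.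
Variables (a b c al : R * R) (p : R).
Hypothesis p1 : 1 < p.
Hypothesis bd : bounded_to_Linf R n K a b c (1%R, p) al.

Local Notation r := dyad.

(** [e2] and [C] do not depend on the boxes. The box in [u] leaves only its height [k]: since the
    first exponent is 1, its volume and its weight [k ^ al.1] occur linearly on both sides and
    cancel. *)
Lemma test_inequality : exists2 e2 : R, 0 < e2 & exists2 C : R, 0 <= C &
  forall (h k j lam : R) (N : nat) (mm L : nat -> R),
  0 < h -> 0 < k -> 0 < j -> 0 < lam -> (forall i, 0 <= mm i) -> (forall i, 0 < L i) ->
  (forall i, (i < N)%N -> L i <= e2 * (j + r lam i)) ->
  h `^ a.1 * k `^ (b.1 - al.1) * (h + k) `^ (- c.1) * (j `^ a.2 *
    \sum_(i < N) mm i * r lam i `^ b.2 * (j + r lam i) `^ (- c.2) * vol m (L i) (r lam i))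
  <= C * (\sum_(i < N) mm i `^ p * r lam i `^ al.2 * vol m (L i) (r lam i)) `^ p^-1.
Proof.
have [_ _ reK] := gK; have [d d0 Hd] := reK c.1 c.2.
have [C0 HC] := bd.
(* [box_kernel] needs an aperture of at most 1. *)
pose dl := Num.min d 1; pose e2 := dl / (8 * (2 * m%:R + 1)).
have dl0 : 0 < dl by rewrite lt_min d0 ltr01.
have dl1 : dl <= 1 by rewrite ge_min lexx orbT.
have dld : dl <= d by rewrite ge_min lexx.
have M0 : 0 < 2 * m%:R + 1 :> R by rewrite ltr_wpDl// mulr_ge0.
have e20 : 0 < e2 by rewrite divr_gt0// mulr_gt0.
exists e2 => //.
pose P0 := 2^-1 * (4 `^ (- `|a.1|) * 4 `^ (- `|a.2|) * (4 `^ (- `|c.1|) * 4 `^ (- `|c.2|)) *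
  (4 `^ (- `|b.1|) * 4 `^ (- `|b.2|))) : R.
have P00 : 0 < P0 by rewrite !mulr_gt0 ?powR_gt0 ?invr_gt0.
exists (`|C0| * 4 `^ `|al.1| * (4 `^ `|al.2|) `^ p^-1 / P0).
  by rewrite !mulr_ge0 ?powR_ge0 ?invr_ge0 ?(ltW P00).
move=> h k j lam N mm L h0 k0 j0 lam0 mm0 L0 hL.
(* Each size is [e2] times the height of its own box, hence at most [e2] times any sum of heights
   containing it. *)
pose Lz := e2 * h; pose Lu := e2 * k; pose Lw := e2 * j.
have Lz0 : 0 < Lz by rewrite mulr_gt0.
have Lu0 : 0 < Lu by rewrite mulr_gt0.
have Lw0 : 0 < Lw by rewrite mulr_gt0.
pose f := test m Lu k lam N mm L.
set S := \sum_(i < N) mm i * r lam i `^ b.2 * _ * _.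
set M := \sum_(i < N) mm i `^ p * _ * _.
have fle := test_mixed_norm m Lu k lam N mm L Lu0 k0 lam0 mm0 L0 al p p1.
rewrite -/f -/M in fle.
have Lf : in_Lmixed R n (1%R, p) al f.
  have [mr mi] := measurable_test m Lu k lam N mm L.
  by split=> //; split=> //; apply: le_lt_trans fle _; rewrite ltry.
have pos : (0 < dV2 R n (box m Lz h `*` box m Lw j))%E.
  rewrite [X in (_ < X)%E](_ : _ = (vol m Lz h * vol m Lw j)%:E).
    by rewrite lte_fin mulr_gt0 ?vol_gt0.
  rewrite EFinM -!measure_box//.
  by apply: product_measure1E; exact: measurable_box.
have [[z w] [/= hz hw] H] := ae_exists _ _ _ _ _ _ (HC f Lf)
  (measurableX (measurable_box m Lz h) (measurable_box m Lw j)) pos.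
have [ci op_le] := H (conj (box_sub m _ _ h0 _ hz) (box_sub m _ _ j0 _ hw)).
have hLz : Lz <= e2 * (h + k) by rewrite ler_wpM2l ?(ltW e20)// lerDl ltW.
have hLu : Lu <= e2 * (h + k) by rewrite ler_wpM2l ?(ltW e20)// lerDr ltW.
have hLw i : (i < N)%N -> Lw <= e2 * (j + r lam i).
  by move=> _; rewrite ler_wpM2l ?(ltW e20)// lerDl ltW// dyad_gt0.
have Kre z' u w' e : TB R n z' -> TB R n u -> TB R n w' -> TB R n e ->
  `|complex.Im (rho2 R n z' u)| <= dl * complex.Re (rho2 R n z' u) ->
  `|complex.Im (rho2 R n w' e)| <= dl * complex.Re (rho2 R n w' e) ->
  2^-1 * (cmod R (rho2 R n z' u) `^ (- c.1) * cmod R (rho2 R n w' e) `^ (- c.2))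
    <= complex.Re (K z' u c.1 * K w' e c.2).
  move=> t1 t2 t3 t4 i1 i2; apply: Hd => //.
    by apply: (le_trans i1); rewrite ler_wpM2r// ltW// Re_rho2_gt0.
  by apply: (le_trans i2); rewrite ler_wpM2r// ltW// Re_rho2_gt0.
have int_ge := test_integral_ge m Lu k lam N mm L Lu0 k0 lam0 mm0 L0 K b c j h dl e2 Lz Lw
  j0 h0 dl0 dl1 erefl Kre Lz0 Lw0 hLz hLu hLw hL z w hz hw ci.
rewrite -/f in int_ge.
have /andP[pz _] := rho_box m _ _ _ a.1 h0 hz.
have /andP[pw _] := rho_box m _ _ _ a.2 j0 hw.
set I := cmod R (cint _ _ _) in int_ge.
have opE : cmod R (op_value R n K a b c f (z, w)) = rh z `^ a.1 * rh w `^ a.2 * I.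
  by rewrite /op_value cmodM cmod_real ger0_norm// mulr_ge0 ?powR_ge0.
have V0 : 0 < vol m Lu k by exact: vol_gt0.
have S0 : 0 <= S.
  apply: sumr_ge0 => i _; rewrite mulr_ge0 ?(ltW (vol_gt0 _ _ _ _ _)) ?dyad_gt0//.
  by rewrite !mulr_ge0 ?powR_ge0.
have low : P0 * (h `^ a.1 * j `^ a.2 * k `^ b.1 * (h + k) `^ (- c.1) * S * vol m Lu k) <=
    cmod R (op_value R n K a b c f (z, w)).
  rewrite opE; apply: le_trans (ler_pM _ _ (ler_pM _ _ pz pw) int_ge); last 4 first.
  - by rewrite !mulr_ge0 ?powR_ge0.
  - apply: sumr_ge0 => i _; rewrite mulr_ge0//; last first.
      by rewrite mulr_ge0// ltW// vol_gt0// dyad_gt0.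
    by rewrite !mulr_ge0 ?powR_ge0 ?invr_ge0.
  - by rewrite mulr_ge0 ?powR_ge0.
  - by rewrite mulr_ge0 ?powR_ge0.
  rewrite le_eqVlt; apply/orP; left; apply/eqP.
  rewrite /S /P0 !(mulr_sumr, mulr_suml); apply: eq_bigr => i _; ring.
have up : cmod R (op_value R n K a b c f (z, w)) <=
    `|C0| * (4 `^ `|al.1| * k `^ al.1 * vol m Lu k * (4 `^ `|al.2| * M) `^ p^-1).
  rewrite -lee_fin EFinM; apply: (le_trans op_le).
  apply: (@le_trans _ _ (`|C0|%:E * mixed_norm R n (1%R, p) al f)%E).
    by apply: lee_wpmul2r; [exact: poweR_ge0|rewrite lee_fin ler_norm].
  by apply: lee_wpmul2l; [rewrite lee_fin|exact: fle].
have := le_trans low up.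
have kE : k `^ b.1 = k `^ (b.1 - al.1) * k `^ al.1 by rewrite -powRD_pos// subrK.
have MM : 0 <= M.
  apply: sumr_ge0 => i _; rewrite mulr_ge0 ?(ltW (vol_gt0 _ _ _ _ _)) ?dyad_gt0//.
  by rewrite !mulr_ge0 ?powR_ge0.
rewrite powRM ?powR_ge0// kE.
set A1 := h `^ a.1; set B1 := k `^ (_ - _); set K1 := k `^ al.1; set H1 := (h + k) `^ _.
set J1 := j `^ a.2; set V := vol m Lu k; set M1 := M `^ _; set Y1 := 4 `^ `|al.1|.
set Y2 := _ `^ p^-1.
have -> : P0 * (A1 * J1 * (B1 * K1) * H1 * S * V) = (K1 * V) * (P0 * (A1 * B1 * H1 * (J1 * S))).
  by ring.
have -> : `|C0| * (Y1 * K1 * V * (Y2 * M1)) = (K1 * V) * (`|C0| * Y1 * Y2 * M1) by ring.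
rewrite ler_pM2l; last by rewrite mulr_gt0// powR_gt0.
move=> hh; rewrite -(ler_pM2l P00); apply: (le_trans hh).
rewrite le_eqVlt; apply/orP; left; apply/eqP; field.
by rewrite gt_eqF.
Qed.

End TestInequality.

(** * Extraction of the conditions on the parameters *)

Section NecessaryConditions.
Context {R : realType}.
Variable m : nat.
Local Notation n := m.+1.
Variable K : Cn R n -> Cn R n -> R -> R[i].
Hypothesis gK : good_kernel m K.
Variables (a b c al : R * R) (p : R).
Hypothesis p1 : 1 < p.
Hypothesis bd : bounded_to_Linf R n K a b c (1%R, p) al.

Let kappa e2 : R := 2 * 4 ^+ m * e2 ^+ n.

Let p0 : 0 < p. Proof. exact: lt_trans p1. Qed.

Lemma vol_const (e2 x : R) : 0 < e2 -> vol m e2 x = kappa e2 * x.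
Proof. by move=> e20; rewrite volE// ltW. Qed.

(** When the horizontal size follows the height, the volume has degree [n + 1]; with the fixed size
    of [vol_const] it has degree 1. *)
Lemma vol_scaled (e2 x : R) : 0 < e2 -> 0 < x ->
  vol m (e2 * x) x = kappa e2 * x `^ (n%:R + 1).
Proof.
move=> e20 x0; rewrite volE ?(ltW (mulr_gt0 e20 x0))// powRD_pos// powRr1 ?(ltW x0)//.
by rewrite powR_mulrn ?(ltW x0)// exprMn /kappa; ring.
Qed.

Lemma kappa_gt0 e2 : 0 < e2 -> 0 < kappa e2.
Proof. by move=> e20; rewrite !mulr_gt0 ?exprn_gt0. Qed.

(** The second variable is frozen to one layer at height 1; its contribution is a positive constant
    [W]. *)
Lemma first_variable_bound : exists C : R, forall h k : R, 0 < h -> 0 < k ->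
  h `^ a.1 * k `^ (b.1 - al.1) * (h + k) `^ (- c.1) <= C.
Proof.
have [e2 e20 [C C0 H]] := test_inequality m K gK a b c al p p1 bd.
pose W := (1 : R) `^ a.2 * \sum_(i < 1) 1 * dyad (1 : R) i `^ b.2 *
  (1 + dyad 1 i) `^ (- c.2) * vol m e2 (dyad 1 i).
have W0 : 0 < W.
  have d0 : 0 < dyad (1 : R) 0 by exact: dyad_gt0.
  rewrite /W big_ord1 mulr_gt0 ?powR_gt0// mulr_gt0 ?vol_gt0//.
  by rewrite !mulr_gt0 ?powR_gt0// addr_gt0.
exists (C * (\sum_(i < 1) 1 `^ p * dyad (1 : R) i `^ al.2 * vol m e2 (dyad 1 i)) `^ p^-1 / W).
move=> h k h0 k0; rewrite ler_pdivlMr//.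
apply: (H h k 1 1 1%N (fun=> 1) (fun=> e2)) => // i _.
by rewrite ler_pMr// lerDl ltW// dyad_gt0.
Qed.

(** Letting [h] tend to 0 with [k = 1] gives the sign of [a.1], and exchanging the roles gives that
    of [b.1 - al.1]. Taking [h = k] at all scales forces total degree 0. *)
Lemma first_conditions : [/\ 0 <= a.1, al.1 <= b.1 & c.1 = a.1 + b.1 - al.1].
Proof.
have [C H] := first_variable_bound.
have F0 : 0 < 4 `^ (- `|- c.1|) :> R by exact: powR_gt0.
have low (x : R) : 0 < x -> x <= 1 -> 4 `^ (- `|- c.1|) <= (x + 1) `^ (- c.1).
  move=> x0 x1.
  have /andP[] := powR_between (x + 1) 1 (- c.1) ltr01 ltac:(lra) ltac:(lra).
  by rewrite powR1 mulr1.
split.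
- apply: (powR_bounded_ge0 a.1 (C / 4 `^ (- `|- c.1|))) => x x0 x1.
  rewrite ler_pdivlMr//; apply: le_trans (H x 1 x0 ltr01).
  by rewrite powR1 mulr1 ler_wpM2l ?powR_ge0// low.
- rewrite -subr_ge0.
  apply: (powR_bounded_ge0 (b.1 - al.1) (C / 4 `^ (- `|- c.1|))) => x x0 x1.
  rewrite ler_pdivlMr//; apply: le_trans (H 1 x ltr01 x0).
  by rewrite powR1 mul1r [1 + x]addrC ler_wpM2l ?powR_ge0// low.
have E : a.1 + (b.1 - al.1) - c.1 = 0.
  apply: (powR_bounded_eq0 _ (C / 2 `^ (- c.1))) => x x0.
  rewrite ler_pdivlMr ?powR_gt0//; apply: le_trans (H x x x0 x0).
  have -> : x + x = 2 * x by ring.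
  rewrite [(2 * x) `^ _]powRM ?(ltW x0)// powRD_pos// [x `^ (a.1 + _)]powRD_pos//.
  by rewrite le_eqVlt; apply/orP; left; apply/eqP; ring.
lra.
Qed.

Lemma second_variable_bound : exists2 e2 : R, 0 < e2 & exists2 C : R, 0 <= C &
  forall (j lam : R) (N : nat) (mm L : nat -> R),
  0 < j -> 0 < lam -> (forall i, 0 <= mm i) -> (forall i, 0 < L i) ->
  (forall i, (i < N)%N -> L i <= e2 * (j + dyad lam i)) ->
  j `^ a.2 * (\sum_(i < N) mm i * dyad lam i `^ b.2 * (j + dyad lam i) `^ (- c.2) *
     vol m (L i) (dyad lam i))
  <= C * (\sum_(i < N) mm i `^ p * dyad lam i `^ al.2 * vol m (L i) (dyad lam i)) `^ p^-1.
Proof.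
have [e2 e20 [C C0 H]] := test_inequality m K gK a b c al p p1 bd.
exists e2 => //.
have T0 : 0 < (1 + 1) `^ (- c.1) :> R by rewrite powR_gt0.
exists (C / (1 + 1) `^ (- c.1)); first by rewrite divr_ge0// ltW.
move=> j lam N mm L j0 lam0 mm0 L0 hL.
rewrite mulrAC ler_pdivlMr// mulrC.
by have := H 1 1 j lam N mm L ltr01 ltr01 j0 lam0 mm0 L0 hL; rewrite !powR1 !mul1r.
Qed.

Lemma c2_condition : c.2 = n%:R + 1 + a.2 + b.2 - (n%:R + 1 + al.2) / p.
Proof.
have [e2 e20 [C C0 H]] := second_variable_bound.
have k0 := kappa_gt0 _ e20; set ka := kappa e2 in k0.
(* For one layer with [j = lam = x] and size [e2 x], both sides are powers of [x]; [X] is the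
   difference of their degrees. *)
pose X := a.2 + b.2 - c.2 + (n%:R + 1) - (al.2 + (n%:R + 1)) / p.
suff : X = 0 by rewrite /X => X0; lra.
have T0 : 0 < 2 `^ (- c.2) * ka :> R by rewrite mulr_gt0// powR_gt0.
apply: (powR_bounded_eq0 _ (C * ka `^ p^-1 / (2 `^ (- c.2) * ka))) => x x0.
have := H x x 1%N (fun=> 1) (fun=> e2 * x) x0 x0 (fun=> ler01) (fun=> mulr_gt0 e20 x0).
rewrite !big_ord1 /dyad expr0 mulr1 powR1 !mul1r vol_scaled// -/ka => /(_ _) hh.
have {hh} : x `^ a.2 * (x `^ b.2 * (x + x) `^ (- c.2) * (ka * x `^ (n%:R + 1))) <=
    C * (x `^ al.2 * (ka * x `^ (n%:R + 1))) `^ p^-1.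
  apply: hh => i _; rewrite ler_wpM2l ?(ltW e20)// lerDl.
  by rewrite mulr_ge0 ?(ltW x0)// exprn_ge0.
have -> : x + x = 2 * x by ring.
rewrite [(2 * x) `^ _]powRM ?(ltW x0)//.
rewrite [x `^ al.2 * _]mulrCA [(ka * _) `^ p^-1]powRM ?(ltW k0)//;
  last by rewrite mulr_ge0 ?powR_ge0.
rewrite -(powRD_pos _ al.2 _ x0) -powRrM => hh.
rewrite ler_pdivlMr//.
have XE : x `^ X = x `^ a.2 * x `^ b.2 * x `^ (- c.2) * x `^ (n%:R + 1) *
    x `^ (- ((al.2 + (n%:R + 1)) / p)) by rewrite -!powRD_pos.
have V : x `^ ((al.2 + (n%:R + 1)) / p) * x `^ (- ((al.2 + (n%:R + 1)) / p)) = 1.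
  by rewrite -powRD_pos// subrr powRr0.
have := ler_wpM2r (powR_ge0 x (- ((al.2 + (n%:R + 1)) / p))) hh.
rewrite -[leRHS]mulrA -[X in _ <= _ * X]mulrA V mulr1.
apply: le_trans; rewrite XE le_eqVlt; apply/orP; left; apply/eqP; ring.
Qed.

(* All the terms of the sum on the right are equal to [y] and all those on the left are at
   least [x], so that [x N <= C (y N)^(1/p)] for every [N]. *)
Lemma growth_contradiction (e2 C x y : R) :
  (forall (j lam : R) (N : nat) (mm L : nat -> R),
  0 < j -> 0 < lam -> (forall i, 0 <= mm i) -> (forall i, 0 < L i) ->
  (forall i, (i < N)%N -> L i <= e2 * (j + dyad lam i)) ->
  j `^ a.2 * (\sum_(i < N) mm i * dyad lam i `^ b.2 * (j + dyad lam i) `^ (- c.2) *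
     vol m (L i) (dyad lam i))
  <= C * (\sum_(i < N) mm i `^ p * dyad lam i `^ al.2 * vol m (L i) (dyad lam i)) `^ p^-1) ->
  0 < x -> 0 <= y ->
  ~ (forall N : nat, exists (j : R) (mm L : nat -> R), [/\ 0 < j,
      forall i, 0 <= mm i, forall i, 0 < L i &
      forall i, (i < N.+1)%N -> [/\ L i <= e2 * (j + dyad 1 i),
        mm i `^ p * dyad 1 i `^ al.2 * vol m (L i) (dyad 1 i) = y &
        x <= j `^ a.2 * (mm i * dyad 1 i `^ b.2 * (j + dyad 1 i) `^ (- c.2) *
               vol m (L i) (dyad 1 i))]]).
Proof.
move=> H x0 y0 G; apply: (linear_not_powR x y C p x0 y0 p1) => N.
have [j [mm [L [j0 mm0 L0 hG]]]] := G N.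
have h1 i : (i < N.+1)%N -> L i <= e2 * (j + dyad 1 i) by move=> /hG[].
have := H j 1 N.+1 mm L j0 ltr01 mm0 L0 h1.
have -> : \sum_(i < N.+1) mm i `^ p * dyad 1 i `^ al.2 * vol m (L i) (dyad 1 i) =
    y * N.+1%:R.
  rewrite (eq_bigr (fun=> y)) => [|i _]; last by have [] := hG i (ltn_ord i).
  by rewrite sumr_const card_ord mulr_natr.
apply: le_trans; rewrite mulr_sumr.
have -> : x * N.+1%:R = \sum_(i < N.+1) x by rewrite sumr_const card_ord mulr_natr.
by apply: ler_sum => i _; have [] := hG i (ltn_ord i).
Qed.

Lemma dyad1_le1 i : dyad (1 : R) i <= 1.
Proof. by rewrite /dyad mul1r exprn_ile1 ?invr_ge0// invf_le1// ler1n. Qed.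

(** The point [w] stays at height 1 while layers of fixed size approach the boundary. If the
    condition failed, the degree of each left-hand term in the height [d <= 1] would be at most 0,
    so no term would decay. *)
Lemma b2_condition : al.2 + 1 < p * (b.2 + 1).
Proof.
rewrite ltNge; apply/negP => hb.
have [e2 e20 [C C0 H]] := second_variable_bound.
have k0 := kappa_gt0 _ e20.
have F0 : 0 < 4 `^ (- `|- c.2|) :> R by exact: powR_gt0.
apply: (growth_contradiction e2 C (kappa e2 * 4 `^ (- `|- c.2|)) (kappa e2) H).
- by rewrite mulr_gt0.
- exact: ltW.
(* The weights make [mm^p d^(al.2) d = 1], so every layer contributes [kappa e2] to the norm. *)
move=> N; exists 1, (fun i => dyad 1 i `^ (- ((al.2 + 1) / p))), (fun=> e2).
split=> // [i|i _]; first exact: powR_ge0.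
have d0 : 0 < dyad (1 : R) i by exact: dyad_gt0.
have d1 := dyad1_le1 i; set d := dyad 1 i in d0 d1 *.
rewrite vol_const//; split.
- by rewrite ler_pMr// lerDl ltW.
- rewrite -powRrM mulNr divfK ?gt_eqF//.
  rewrite -[X in _ * (_ * X)](powRr1 (ltW d0)) mulrCA -!powRD_pos//.
  have -> : - (al.2 + 1) + al.2 + 1 = 0 by ring.
  by rewrite powRr0 mulr1.
have /andP[lo _] := powR_between (1 + d) 1 (- c.2) ltr01 ltac:(lra) ltac:(lra).
rewrite powR1 mulr1 in lo.
rewrite powR1 mul1r.
set A := d `^ (- _); set B := d `^ b.2; set E := (1 + d) `^ _.
have hE : 1 <= A * B * d.
  rewrite /A /B -[X in _ * X](powRr1 (ltW d0)) -!powRD_pos// -[leLHS](powRr0 d).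
  apply: ger_powR; first by rewrite d0.
  rewrite -(ler_pM2l p0) mulr0.
  have -> : p * (- ((al.2 + 1) / p) + b.2 + 1) = p * (b.2 + 1) - (al.2 + 1).
    by field; rewrite gt_eqF.
  by rewrite subr_le0.
have -> : A * B * E * (kappa e2 * d) = kappa e2 * E * (A * B * d) by ring.
rewrite -[leLHS]mulr1 ler_pM// ?(ltW (mulr_gt0 k0 F0))//.
by rewrite ler_wpM2l// ltW.
Qed.

(** Here [w] lies below all the layers, so [j + d] is comparable to [d]. By [c2_condition] each
    left-hand term is comparable to [(j / d)^(a.2)], which is at least 1 if [a.2 <= 0]. *)
Lemma a2_condition : 0 < a.2.
Proof.
rewrite ltNge; apply/negP => ha.
have [e2 e20 [C C0 H]] := second_variable_bound.
have k0 := kappa_gt0 _ e20.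
have F0 : 0 < 4 `^ (- `|- c.2|) :> R by exact: powR_gt0.
apply: (growth_contradiction e2 C (kappa e2 * 4 `^ (- `|- c.2|)) (kappa e2) H).
- by rewrite mulr_gt0.
- exact: ltW.
(* Height [dyad 1 N.+1] is at most half that of each layer used. The size follows the height, which
   changes the degree [1] in the weights to [n + 1]. *)
move=> N; exists (dyad 1 N.+1), (fun i => dyad 1 i `^ (- ((al.2 + (n%:R + 1)) / p))),
  (fun i => e2 * dyad 1 i).
have j0 : 0 < dyad (1 : R) N.+1 by exact: dyad_gt0.
split=> // [i|i|i iN]; [exact: powR_ge0|by rewrite mulr_gt0// dyad_gt0|].
have d0 : 0 < dyad (1 : R) i by exact: dyad_gt0.
have := dyad_half (1 : R) ltr01 _ _ iN.
set d := dyad 1 i in d0 *; set j := dyad 1 N.+1 in j0 * => dj.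
rewrite vol_scaled//; split.
- by rewrite ler_wpM2l ?(ltW e20)// lerDr ltW.
- rewrite -powRrM mulNr divfK ?gt_eqF// mulrCA -!powRD_pos//.
  have -> : - (al.2 + (n%:R + 1)) + al.2 + (n%:R + 1) = 0 :> R by ring.
  by rewrite powRr0 mulr1.
have /andP[lo _] := powR_between (j + d) d (- c.2) d0 ltac:(lra) ltac:(lra).
set A := d `^ (- _); set B := d `^ b.2; set E := (j + d) `^ _; set G := d `^ (_ + _).
set Y := 4 `^ _ in lo F0 *.
have hj : 1 <= j `^ a.2 * (A * B * d `^ (- c.2) * G).
  rewrite /A /B /G -!powRD_pos//.
  have -> : - ((al.2 + (n%:R + 1)) / p) + b.2 + - c.2 + (n%:R + 1) = - a.2.
    by rewrite c2_condition; field; rewrite gt_eqF.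
  have -> : 1 = d `^ a.2 * d `^ (- a.2) :> R by rewrite -powRD_pos// subrr powRr0.
  rewrite ler_wpM2r ?powR_ge0// -[a.2]opprK; apply: ler_powRN => //; lra.
have -> : j `^ a.2 * (A * B * E * (kappa e2 * G)) =
  kappa e2 * (E * (j `^ a.2 * (A * B * G))) by ring.
rewrite ler_wpM2l ?(ltW k0)//.
have q0 : 0 <= j `^ a.2 * (A * B * G) by rewrite !mulr_ge0 ?powR_ge0.
apply: le_trans (ler_wpM2r q0 lo).
have -> : Y * d `^ (- c.2) * (j `^ a.2 * (A * B * G)) =
  Y * (j `^ a.2 * (A * B * d `^ (- c.2) * G)) by ring.
by rewrite -[leLHS]mulr1 ler_wpM2l// ltW.
Qed.

End NecessaryConditions.

Theorem theorem6p7 (R : realType) (n : nat) (n_gt0 : (0 < n)%N)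
  (p2 : R) (a b c alpha : R * R) :
  1 < p2 -> -1 < alpha.1 -> -1 < alpha.2 ->
  let p : R * R := (1, p2) in
  let cond : Prop :=
    0 <= a.1 /\ 0 < a.2 /\ alpha.1 <= b.1 /\ alpha.2 + 1 < p2 * (b.2 + 1) /\
    c.1 = a.1 + b.1 - alpha.1 /\
    c.2 = n%:R + 1 + a.2 + b.2 - (n%:R + 1 + alpha.2) / p2 in
  (S_bounded R n a b c p alpha <-> T_bounded R n a b c p alpha) /\
  (T_bounded R n a b c p alpha <-> cond).
Proof.
move=> p1 _ _ p cond; case: n n_gt0 @cond => [|m] n_gt0 cond.
  by exfalso; rewrite ltnn in n_gt0.
(* [S] and [T] are never compared directly: each is equivalent to [cond] through [good_kernel]. *)
have main K : good_kernel m K -> bounded_to_Linf R m.+1 K a b c p alpha <-> cond.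
  move=> gK; split=> [bd|[a1 [a2 [b1 [b2 [c1 c2]]]]]].
    have [h1 h2 h3] := first_conditions m K gK a b c alpha p2 p1 bd.
    split=> //; split; first exact: (a2_condition m K gK a b c alpha p2 p1 bd).
    split=> //; split; first exact: (b2_condition m K gK a b c alpha p2 p1 bd).
    by split=> //; exact: (c2_condition m K gK a b c alpha p2 p1 bd).
  exact: (good_kernel_bounded m K gK a b c alpha p2 p1 a1 a2 b1 b2 c1 c2).
have hS := main _ (Sker_good m); have hT := main _ (Tker_good m).
by split; [exact: iff_trans hS (iff_sym hT)|exact: hT].
Qed.
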